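(* Let $X$ and $Y$ be Banach spaces, $\Omega\subset X$, $F:X\rightrightarrows Y$, $\bar x\in\Omega$, $\bar y\in F(\bar x)$, and let $\Xi$ be a nonempty family of subsets of $Y$. Suppose that $\Omega$, $\mathrm{gph}\,F$ and all members of $\Xi$ are closed, and that the triple $\{F,\Omega,\Xi\}$ is approximately stationary at $(\bar x,\bar y)$. If condition $(QC)_C$ is satisfied, then there is an $M>0$ such that, for any $\varepsilon>0$, there exist $(x_1,y_1)\in\mathrm{gph}\,F\cap B_{\varepsilon}(\bar x,\bar y)$, $x_2\in\Omega\cap B_{\varepsilon}(\bar x)$, $A\in\Xi$, $y_2\in A\cap B_\varepsilon(\bar y)$, and $y^*\in N^C_{A}(y_2)+\varepsilon\mathbb B_{Y^*}$ such that $\|y^*\|=1$ and $$0\in D^{*C}F(x_1,y_1)(y^* )+N^C_\Omega(x_2)\cap(M\mathbb B_{X^*})+\varepsilon\mathbb B_{X^*}.$$ If $X$ and $Y$ are Asplund and condition $(QC)_F$ is satisfied, then there is an $M>0$ such that, for any $\varepsilon>0$, there exist $(x_1,y_1)\in\mathrm{gph}\,F\cap B_{\varepsilon}(\bar x,\bar y)$, $x_2\in\Omega\cap B_{\varepsilon}(\bar x)$, $A\in\Xi$, $y_2\in A\cap B_\varepsilon(\bar y)$, and $y^*\in N^F_{A}(y_2)+\varepsilon\mathbb B_{Y^*}$ such that $\|y^*\|=1$ and $$0\in D^{*F}F(x_1,y_1)(y^* )+N^F_\Omega(x_2)\cap(M\mathbb B_{X^*})+\varepsilon\mathbb B_{X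^*}.$$
   Context: Notation: $B_\delta(x)$ is the open ball; $\mathbb B$ (with a subscript for the space) is the open unit ball; $X\times Y$ carries the maximum norm; $d(x,S)=\inf_{u\in S}\|u-x\|$ with $d(x,\emptyset)=+\infty$; $\mathrm{gph}\,F=\{(x,y)\mid y\in F(x)\}$ for a set-valued mapping $F$ (values may be empty); the image of a set under a set-valued mapping is the union of the images of its points. Normal cones: for a subset $S$ of a normed space $Z$ and $\bar z\in S$, the Fréchet normal cone is $N^F_S(\bar z)=\{z^*\in Z^*\mid \limsup_{S\ni z\to\bar z,\,z\ne\bar z}\langle z^*,z-\bar z\rangle/\|z-\bar z\|\le0\}$; the Clarke tangent cone $T^C_S(\bar z)$ is the set of $w\in Z$ such that for all $z_k\to\bar z$ with $z_k\in S$ and all $t_k\downarrow0$ there are $w_k\to w$ with $z_k+t_kw_k\in S$ for all $k$; the Clarke normal cone is $N^C_S(\bar z)=\{z^*\in Z^*\mid\langle z^*,w\rangle\le0\ \forall w\in T^C_S(\bar z)\}$. Both are empty by convention if $\bar z\notin S$. Coderivatives: for $(x,y)\in\mathrm{gph}\,F$, $D^{*C}F(x,y)(y^* )=\{x^*\in X^*\mid(x^*,-y^* )\in N^C_{\mathrm{gph}\,F}(x,y)\}$, and $D^{*F}F(x,y)$ is defined in the same way with $N^F$ in place of $N^C$. A Banach space is Asplund if the dual of each of its separable subspaces is separable. Approximate stationarity: a collection $\{\Xi_1,\ldots,\Xi_n\}$ of families of subsets of a normed space $Z$ is approximately stationary at $\bar z\in Z$ if, for any $\varepsilon>0$, there exist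 $\rho\in(0,\varepsilon)$, $A_i\in\Xi_i$ and $z_i\in B_\varepsilon(\bar z)$ $(i=1,\ldots,n)$ such that $\max_{1\le i\le n}d(z_i,A_i)<\varepsilon\rho$ and $\bigcap_{i=1}^n(A_i-z_i)\cap(\rho\mathbb B)=\emptyset$. The triple $\{F,\Omega,\Xi\}$ is approximately stationary at $(\bar x,\bar y)$ if the pair of families $\Xi_1:=\{\mathrm{gph}\,F\}$, $\Xi_2:=\{\Omega\times A\mid A\in\Xi\}$ of subsets of $X\times Y$ is approximately stationary at $(\bar x,\bar y)$. Condition $(QC)_C$: there is an $\varepsilon>0$ such that $\|x_1^*+x_2^*\|\ge\varepsilon$ for all $(x_1,y_1)\in\mathrm{gph}\,F\cap B_{\varepsilon}(\bar x,\bar y)$, $x_2\in\Omega\cap B_{\varepsilon}(\bar x)$, $x_1^*\in D^{*C}F(x_1,y_1)(\varepsilon\mathbb B_{Y^*})$ and $x_2^*\in N^C_\Omega(x_2)$ such that $\|x_1^*\|+\|x_2^*\|=1$. Condition $(QC)_F$ is the same with $N^F$ and $D^{*F}$ in place of $N^C$ and $D^{*C}$. *)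

(* Defs.v *)
From HB Require Import structures.
From mathcomp Require Import all_boot all_order all_algebra.
From mathcomp Require Import all_classical all_reals all_analysis.

Set Implicit Arguments.
Unset Strict Implicit.
Unset Printing Implicit Defensive.

Import Order.TTheory GRing.Theory Num.Theory.
Import numFieldNormedType.Exports.

Local Open Scope classical_set_scope.
Local Open Scope ring_scope.

(** * Topological dual *)

Definition dual_pred (R : realType) (X : normedModType R) : {pred X -> R^o} :=
  mem [set f : X -> R^o | linear f /\ continuous f].

Lemma dual_submod_closed (R : realType) (X : normedModType R) :
  submod_closed (@dual_pred R X).
Proof.
split=> [|a f g]; rewrite !inE.
  split=> [b x y|]; first by rewrite scaler0 addr0.
  exact: cst_continuous.
move=> [lf cf] [lg cg]; split=> [b x y|x].
  rewrite [LHS](_ : _ = a *: f (b *: x + y) + g (b *: x + y))// lf lg.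
  rewrite [in RHS](_ : (a *: f + g) x = a *: f x + g x)//.
  rewrite [in RHS](_ : (a *: f + g) y = a *: f y + g y)//.
  by rewrite !scalerDr !scalerA addrACA (mulrC a).
by apply: cvgD; [apply: cvgZr; exact: cf|exact: cg].
Qed.

HB.instance Definition _ (R : realType) (X : normedModType R) :=
  GRing.isSubmodClosed.Build R (X -> R^o) (@dual_pred R X)
    (@dual_submod_closed R X).

Record dual (R : realType) (X : normedModType R) := Dual {
  dual_val :> X -> R^o ;
  _ : dual_val \in @dual_pred R X
}.

HB.instance Definition _ (R : realType) (X : normedModType R) :=
  [isSub of dual X for @dual_val R X].
HB.instance Definition _ (R : realType) (X : normedModType R) :=
  [Choice of dual X by <:].
HB.instance Definition _ (R : realType) (X : normedModType R) :=
  [SubChoice_isSubLmodule of dual X by <:].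

Section dual_norm.
Context (R : realType) (X : normedModType R).
Implicit Types f g : dual X.

Lemma dual_linear f : linear f.
Proof. by case: f => f /=; rewrite inE => -[]. Qed.

Lemma dual_continuous f : continuous f.
Proof. by case: f => f /=; rewrite inE => -[]. Qed.

Definition dual_norm f : R := sup [set `|f x| | x in [set x : X | `|x| <= 1]].

Lemma dual_scaleE f (a : R) x : f (a *: x) = a * f x.
Proof.
have f0 : f 0 = 0.
  have := dual_linear f 1 0 0; rewrite !scale1r addr0 => h.
  by apply: (addrI (f 0)); rewrite addr0 -h.
by have := dual_linear f a x 0; rewrite !addr0 f0 addr0.
Qed.

Lemma dual_has_sup f :
  has_sup [set `|f x| | x in [set x : X | `|x| <= 1]].
Proof.
split; first by exists `|f 0|, 0 => //=; rewrite normr0.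
pose L : {linear X -> R^o} :=
  HB.pack (f : X -> R^o) (GRing.isLinear.Build R X R^o _ f (dual_linear f)).
have : bounded_near L (nbhs (0 : X)).
  by apply/linear_bounded_continuous; exact: dual_continuous.
move=> /bounded_funP /(_ 1) [M LM].
by exists M => _ [x /= x1 <-]; exact: LM.
Qed.

Lemma dual_norm_ge0 f : 0 <= dual_norm f.
Proof.
apply: le_trans (normr_ge0 (f 0)) _; apply: ub_le_sup.
  by have [] := dual_has_sup f.
by exists 0 => //=; rewrite normr0.
Qed.

Lemma dual_norm_bound f x : `|f x| <= dual_norm f * `|x|.
Proof.
have [->|x0] := eqVneq x 0.
  by rewrite -(scale0r (0 : X)) dual_scaleE mul0r scale0r !normr0 mulr0.
have nx : 0 < `|x| by rewrite normr_gt0.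
rewrite -ler_pdivrMr// mulrC -(ger0_norm (ltW (_ : 0 < `|x|^-1))) ?invr_gt0//.
rewrite -normrM -dual_scaleE; apply: ub_le_sup.
  by have [] := dual_has_sup f.
by exists (`|x|^-1 *: x) => //=; rewrite normrZ ger0_norm ?invr_ge0// mulVf ?gt_eqF.
Qed.

Lemma dual_norm_le f (M : R) :
  (forall x, `|x| <= 1 -> `|f x| <= M) -> dual_norm f <= M.
Proof.
move=> fM; apply: ge_sup; first by have [] := dual_has_sup f.
by move=> _ [x /= x1 <-]; exact: fM.
Qed.

Lemma dual_normD f g : dual_norm (f + g) <= dual_norm f + dual_norm g.
Proof.
apply: dual_norm_le => x x1; apply: le_trans (ler_normD _ _) _.
by apply: lerD; apply: ub_le_sup;
  [have [] := dual_has_sup f|exists x|have [] := dual_has_sup g|exists x].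
Qed.

Lemma dual_normZ_le (a : R) f : dual_norm (a *: f) <= `|a| * dual_norm f.
Proof.
apply: dual_norm_le => x x1; rewrite [X in `|X|](_ : _ = a * f x)// normrM.
rewrite ler_wpM2l//; apply: ub_le_sup; first by have [] := dual_has_sup f.
by exists x.
Qed.

Lemma dual_normZ (a : R) f : dual_norm (a *: f) = `|a| * dual_norm f.
Proof.
apply/eqP; rewrite eq_le dual_normZ_le /=.
have [->|a0] := eqVneq a 0; first by rewrite normr0 mul0r dual_norm_ge0.
rewrite -ler_pdivlMl ?normr_gt0// -normfV.
by apply: le_trans (dual_normZ_le _ _); rewrite scalerA mulVf// scale1r.
Qed.

Lemma dual_norm0_eq0 f : dual_norm f = 0 -> f = 0.
Proof.
move=> f0; apply/val_inj/funext => x /=.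
apply/normr0_eq0/le_anti; rewrite normr_ge0 andbT.
by apply: le_trans (dual_norm_bound f x) _; rewrite f0 mul0r.
Qed.

End dual_norm.

HB.instance Definition _ (R : realType) (X : normedModType R) :=
  @Lmodule_isNormed.Build R (dual X) (@dual_norm R X)
    (@dual_normD R X) (@dual_normZ R X) (@dual_norm0_eq0 R X).

(** The functional [(x, y) |-> u x + v y]; every element of the dual of
    [X * Y] is of this form. *)
Section dual_pair.
Context (R : realType) (X Y : normedModType R) (u : dual X) (v : dual Y).

Definition dual_pair_fun (z : X * Y) : R^o := u z.1 + v z.2.

Lemma dual_pair_subproof : dual_pair_fun \in @dual_pred R (X * Y)%type.
Proof.
rewrite inE; split=> [a x y|z].
  rewrite /dual_pair_fun /= !dual_linear.
  by rewrite scalerDr addrACA.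
apply: cvgD.
  by apply: (@cvg_comp _ _ _ fst u _ (nbhs z.1)); [exact: cvg_fst|exact: dual_continuous].
by apply: (@cvg_comp _ _ _ snd v _ (nbhs z.2)); [exact: cvg_snd|exact: dual_continuous].
Qed.

Definition dual_pair : dual (X * Y)%type := Dual dual_pair_subproof.

End dual_pair.

(** * Linear subspaces as normed spaces, and Asplund spaces *)

Record subspace_of (R : realType) (X : normedModType R) (L : submodClosed X) :=
  SubspaceOf { subspace_val :> X ; _ : subspace_val \in L }.

HB.instance Definition _ (R : realType) (X : normedModType R)
  (L : submodClosed X) := [isSub of subspace_of L for @subspace_val R X L].
HB.instance Definition _ (R : realType) (X : normedModType R)
  (L : submodClosed X) := [Choice of subspace_of L by <:].
HB.instance Definition _ (R : realType) (X : normedModType R)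
  (L : submodClosed X) := [SubChoice_isSubLmodule of subspace_of L by <:].

Section subspace_norm.
Context (R : realType) (X : normedModType R) (L : submodClosed X).
Implicit Types x y : subspace_of L.

Definition subspace_norm x : R := `|subspace_val x|.

Lemma subspace_normD x y :
  subspace_norm (x + y) <= subspace_norm x + subspace_norm y.
Proof. exact: ler_normD. Qed.

Lemma subspace_normZ (a : R) x :
  subspace_norm (a *: x) = `|a| * subspace_norm x.
Proof. exact: normrZ. Qed.

Lemma subspace_norm0_eq0 x : subspace_norm x = 0 -> x = 0.
Proof. by move=> /normr0_eq0 x0; exact/val_inj. Qed.

End subspace_norm.

HB.instance Definition _ (R : realType) (X : normedModType R)
    (L : submodClosed X) :=
  @Lmodule_isNormed.Build R (subspace_of L) (@subspace_norm R X L)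
    (@subspace_normD R X L) (@subspace_normZ R X L) (@subspace_norm0_eq0 R X L).

Definition separable (T : topologicalType) : Prop :=
  exists2 D : set T, countable D & dense D.

Definition asplund (R : realType) (X : completeNormedModType R) : Prop :=
  forall L : submodClosed X,
    separable (subspace_of L) -> separable (dual (subspace_of L)).

(** * Normal cones and coderivatives *)

Section normal_cones.
Context (R : realType) (Z : normedModType R).

(** When [zbar] is isolated in [S] the upper limit is [-oo], and the cone is
    the whole dual. *)
Definition frechet_normal (S : set Z) (zbar : Z) : set (dual Z) :=
  [set f | S zbar /\
    (limf_esup (fun z => (f (z - zbar) / `|z - zbar|)%:E) (within S zbar^')
      <= 0)%E].

Definition clarke_tangent (S : set Z) (zbar : Z) : set Z :=
  [set w | forall (z : nat -> Z) (t : nat -> R),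
    (forall k, S (z k)) -> z @ \oo --> zbar ->
    (forall k, 0 < t k) -> t @ \oo --> 0 ->
    exists2 v : nat -> Z, v @ \oo --> w & forall k, S (z k + t k *: v k)].

Definition clarke_normal (S : set Z) (zbar : Z) : set (dual Z) :=
  [set f | S zbar /\ forall w, clarke_tangent S zbar w -> f w <= 0].

(** Distance in the extended reals, [+oo] for the empty set. *)
Definition dist (z : Z) (S : set Z) : \bar R :=
  ereal_inf [set `|u - z|%:E | u in S].

Definition set_add (A B : set Z) : set Z := [set a + b | a in A & b in B].

Definition approx_stationary (n : nat) (Xi : 'I_n -> set (set Z)) (zbar : Z) :
    Prop :=
  forall eps : R, 0 < eps ->
    exists (rho : R) (A : 'I_n -> set Z) (z : 'I_n -> Z),
      [/\ 0 < rho < eps,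
          forall i, Xi i (A i),
          forall i, ball zbar eps (z i),
          (\big[maxe/-oo]_(i < n) dist (z i) (A i) < (eps * rho)%:E)%E &
          \bigcap_(i in [set: 'I_n]) [set a - z i | a in A i]
            `&` ball (0 : Z) rho = set0].

End normal_cones.

Definition normal_cone_map (R : realType) :=
  forall Z : normedModType R, set Z -> Z -> set (dual Z).

Section set_valued.
Context (R : realType) (X Y : normedModType R).

Definition gph (F : X -> set Y) : set (X * Y) := [set p | F p.1 p.2].

Definition coderivative (N : normal_cone_map R) (F : X -> set Y) (p : X * Y)
    (ystar : dual Y) : set (dual X) :=
  [set xstar | N _ (gph F) p (dual_pair xstar (- ystar))].

Definition triple_families (F : X -> set Y) (Omega : set X) (Xi : set (set Y))
    (i : 'I_2) : set (set (X * Y)) :=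
  if i == ord0 then [set gph F] else [set Omega `*` A | A in Xi].

Definition triple_approx_stationary (F : X -> set Y) (Omega : set X)
    (Xi : set (set Y)) (xbar : X) (ybar : Y) : Prop :=
  approx_stationary (triple_families F Omega Xi) (xbar, ybar).

Definition qualification (N : normal_cone_map R) (F : X -> set Y)
    (Omega : set X) (xbar : X) (ybar : Y) : Prop :=
  exists2 eps : R, 0 < eps &
    forall (x1 : X) (y1 : Y) (x2 : X) (x1s x2s : dual X),
      (gph F `&` ball (xbar, ybar) eps) (x1, y1) ->
      (Omega `&` ball xbar eps) x2 ->
      (\bigcup_(ys in ball (0 : dual Y) eps) coderivative N F (x1, y1) ys) x1s ->
      N _ Omega x2 x2s ->
      `|x1s| + `|x2s| = 1 ->
      eps <= `|x1s + x2s|.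

End set_valued.

(* Main.v *)
Require Import Defs.
From HB Require Import structures.
From mathcomp Require Import all_boot all_order all_algebra.
From mathcomp Require Import all_classical all_reals all_analysis.
From mathcomp Require Import ring lra.

Import Order.TTheory GRing.Theory Num.Theory.
Import numFieldNormedType.Exports.

Local Open Scope classical_set_scope.
Local Open Scope ring_scope.

Set Implicit Arguments.
Unset Strict Implicit.
Unset Printing Implicit Defensive.

(* Suppose [gph F] and [Omega `*` A], translated by [z] and [z'], do not meet in
   the ball of radius [rho], while they contain points [e * rho]-close to [z]
   and [z']. Ekeland's principle gives a minimizer [w] on the product of the
   two sets of the convex function
     [phi (a, b) = |(a - z) - (b - z')| + 48 e |(a, b) - w|],
   at which the first term is positive. A sum rule that yields a normal [(p, q)]
   to the product at a point near [w], with [- (p, q)] an approximate subgradient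
   of [phi], then gives normals with [|p| >= 1 / 2] and [|p + q|] small. The
   qualification condition keeps the [Y]-component of [p] away from zero, and
   dividing by its norm gives the multipliers.
   For Clarke normals the sum rule is a Hahn-Banach separation from the tangent
   cone. For Frechet normals, assume first that the dual has a dense sequence
   [g n]: infimal convolution with the functions [g n y + |y|^2 / (2 c n)] turns
   a convex Lipschitz function into a Frechet differentiable one that is
   uniformly close to it, and with smooth approximations of the norm as
   perturbations the variational principle of Borwein and Preiss yields exact
   Frechet normals. The Asplund case reduces to this one, because by
   Hahn-Banach the existence of the required normal is a condition on finite
   subsets, so that its failure is inherited by a suitable separable subspace. *)

(** * The Hahn-Banach theorem and convex sandwiches *)

Section infimum.
Context (R : realType).
Implicit Types (E : set R) (m x e : R).

Lemma inf_le E m x : lbound E m -> E x -> inf E <= x.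
Proof. by move=> Em Ex; apply: ge_inf => //; exists m. Qed.

Lemma inf_lt_adherent E m e : E !=set0 -> lbound E m -> 0 < e ->
  exists2 x, E x & x < inf E + e.
Proof. by move=> E0 Em e0; apply: inf_adherent => //; split=> //; exists m. Qed.

Lemma ler_addeps (a b : R) : (forall e, 0 < e -> a <= b + e) -> a <= b.
Proof. by move=> h; apply/ler_addgt0Pr. Qed.

End infimum.

Section hahn_banach.
Context (R : realType) (V : lmodType R).

Definition sublinear (p : V -> R) :=
  (forall x y, p (x + y) <= p x + p y) /\
  (forall (a : R) x, 0 < a -> p (a *: x) = a * p x).

Lemma sublinear0 p : sublinear p -> p 0 = 0.
Proof. by move=> [_ /(_ 2 0 (ltr0n _ 2))]; rewrite scaler0 => h; lra. Qed.

Lemma sublinear_opp p x : sublinear p -> - p (- x) <= p x.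
Proof.
move=> sp; have := sp.1 x (- x); rewrite subrr sublinear0//; lra.
Qed.

(** The reverse inequality is the given one with factor [a^-1] at the point [a *: x]. *)
Lemma sublinear_scale_le p : (forall x y, p (x + y) <= p x + p y) ->
  (forall (a : R) x, 0 < a -> p (a *: x) <= a * p x) -> sublinear p.
Proof.
move=> pD pZ; split=> // a x a0; apply/eqP; rewrite eq_le pZ//=.
have := pZ a^-1 (a *: x); rewrite invr_gt0 scalerA mulVf ?gt_eqF// scale1r.
by move=> /(_ a0); rewrite ler_pdivlMl.
Qed.

(** This supplies the bounds of chains for Zorn's lemma. The infimum is finite because all members
    of the chain lie above [- p0 (- x)]. It is subadditive because, of two comparable
    near-minimizers, the smaller one serves both points. *)
Lemma sublinear_chain_inf (A : set (V -> R)) (p0 : V -> R) :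
  A p0 -> (forall p, A p -> sublinear p) ->
  (forall p q, A p -> A q -> (forall x, p x <= q x) \/ (forall x, q x <= p x)) ->
  exists2 q, sublinear q & forall p, A p -> forall x, q x <= p x.
Proof.
move=> Ap0 As tA; pose E x := [set p x | p in A].
have Elb x : lbound (E x) (- p0 (- x)).
  move=> _ [p Ap <-]; have [le|le] := tA _ _ Ap Ap0.
    apply: le_trans (sublinear_opp _ (As _ Ap)).
    by rewrite lerN2.
  by apply: le_trans (le x); apply: sublinear_opp; exact: As.
pose q x := inf (E x).
have E0 x : E x !=set0 by exists (p0 x), p0.
have qle p x : A p -> q x <= p x.
  by move=> Ap; apply: inf_le (Elb x) _; exists p.
exists q => //; last by move=> p Ap x; exact: qle.
apply: sublinear_scale_le => [x y|a x a0].
  apply: ler_addeps => e e0; have e20 : 0 < e / 2 by lra.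
  have [_ [p Ap <-] px] := inf_lt_adherent (E0 x) (Elb x) e20.
  have [_ [p' Ap' <-] py] := inf_lt_adherent (E0 y) (Elb y) e20.
  rewrite -/(q x) in px; rewrite -/(q y) in py.
  have [le|le] := tA _ _ Ap Ap'.
    have := qle _ (x + y) Ap; have := (As _ Ap).1 x y; have := le y; lra.
  have := qle _ (x + y) Ap'; have := (As _ Ap').1 x y; have := le x; lra.
rewrite -ler_pdivrMl//; apply: lb_le_inf => // _ [p Ap <-].
by rewrite ler_pdivrMl// -(As _ Ap).2//; exact: qle.
Qed.

(* A sublinear functional that is minimal for the pointwise order is linear:
   [x |-> inf_(t >= 0) (q (x + t y) - t q y)] is a sublinear functional below
   [q], hence equal to [q], and [t = 1] gives [q x + q y <= q (x + y)]. *)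
Lemma sublinear_minimal_superadditive (q : V -> R) : sublinear q ->
  (forall r, sublinear r -> (forall x, r x <= q x) -> r = q) ->
  forall x y, q x + q y <= q (x + y).
Proof.
move=> sq qmin x y.
pose E z := [set q (z + t *: y) - t * q y | t in [set t : R | 0 <= t]].
have qnonneg (t : R) z : 0 <= t -> q (t *: z) = t * q z.
  rewrite le_eqVlt => /predU1P[<-|]; last exact: sq.2.
  by rewrite scale0r mul0r sublinear0.
have Elb z : lbound (E z) (- q (- z)).
  move=> _ [t /= t0 <-]; rewrite -qnonneg//.
  have := sq.1 (- z) (z + t *: y); rewrite addKr; lra.
have E0 z : E z !=set0 by exists (q (z + 0 *: y) - 0 * q y), 0 => /=.
pose r z := inf (E z).
have rle z t : 0 <= t -> r z <= q (z + t *: y) - t * q y.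
  by move=> t0; apply: inf_le (Elb z) _; exists t.
have sr : sublinear r.
  apply: sublinear_scale_le => [u v|a z a0].
    apply: ler_addeps => e e0; have e20 : 0 < e / 2 by lra.
    have [_ [t /= t0 <-] pt] := inf_lt_adherent (E0 u) (Elb u) e20.
    have [_ [s /= s0 <-] ps] := inf_lt_adherent (E0 v) (Elb v) e20.
    rewrite -/(r u) in pt; rewrite -/(r v) in ps.
    have := rle (u + v) (t + s) (addr_ge0 t0 s0).
    have := sq.1 (u + t *: y) (v + s *: y).
    by rewrite addrACA -scalerDl; lra.
  rewrite -ler_pdivrMl//; apply: lb_le_inf => // _ [t /= t0 <-].
  rewrite ler_pdivrMl//; have := rle (a *: z) (a * t).
  rewrite mulr_ge0 ?(ltW a0)// => /(_ isT).
  by rewrite -scalerA -scalerDr sq.2//; lra.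
have rq : r = q.
  by apply: qmin => // z; have := rle z 0; rewrite lexx scale0r addr0 => /(_ isT); lra.
by have := rle x 1; rewrite rq ler01 scale1r => /(_ isT); lra.
Qed.

Lemma hahn_banach (p : V -> R) : sublinear p ->
  exists2 f : V -> R, linear (f : V -> R^o) & forall x, f x <= p x.
Proof.
move=> sp.
pose T := {q : V -> R | sublinear q /\ forall x, q x <= p x}.
(* The order is reversed, so that a maximal element for Zorn's lemma is a minimal sublinear
   functional. *)
pose rT (q q' : T) := `[< forall x, sval q' x <= sval q x >].
have [|q r s|q r|A tA|[q [sq qp]] qmin] := @Zorn T rT.
- by move=> q; apply/asboolP => x.
- move=> /asboolP qr /asboolP rs; apply/asboolP => x.
  exact: le_trans (rs x) (qr x).
- move: q r => [q qP] [r rP] /asboolP/= qr /asboolP/= rq.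
  apply/eq_exist/funext => x.
  by apply/le_anti/andP; split; [exact: rq|exact: qr].
- have [[t0 At0]|A0] := pselect (A !=set0); last first.
    exists (exist _ p (conj sp (fun x => lexx (p x)))) => s As.
    by exfalso; apply: A0; exists s.
  have [|_ [t At <-]|_ _ [t At <-] [t' At' <-]|q sq qle] :=
      @sublinear_chain_inf [set sval t | t in A] (sval t0).
  + by exists t0.
  + exact: (svalP t).1.
  + by have [/asboolP|/asboolP] := tA _ _ At At'; [right|left].
  + have qp x : q x <= p x.
      by apply: le_trans ((svalP t0).2 x); apply: qle; exists t0.
    exists (exist _ q (conj sq qp)) => s As; apply/asboolP => x /=.
    by apply: qle; exists s.
have {}qmin r : sublinear r -> (forall x, r x <= q x) -> r = q.
  move=> sr rq; have rp x : r x <= p x by exact: le_trans (rq x) (qp x).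
  by have /(congr1 sval) := qmin (exist _ r (conj sr rp)) (asboolT rq).
have qD x y : q (x + y) = q x + q y.
  apply/le_anti; rewrite sq.1 /=.
  exact: sublinear_minimal_superadditive.
have qN x : q (- x) = - q x.
  by have := qD x (- x); rewrite subrr sublinear0//; lra.
exists q => // a x y; rewrite qD; congr (_ + _).
have [a0|a0|->] := ltgtP a 0; last by rewrite !scale0r sublinear0.
- by rewrite -[a]opprK scaleNr qN sq.2 ?oppr_gt0// scaleNr.
- by rewrite sq.2.
Qed.

End hahn_banach.

(** * Elementary estimates for continuous linear functionals *)

HB.instance Definition _ (R : realType) (X : normedModType R) (f : dual X) :=
  GRing.isLinear.Build R X R^o _ (dual_val f) (dual_linear f).

Section dual_theory.
Context (R : realType) (V : normedModType R).
Implicit Types (f g : dual V) (x y : V).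

Lemma dual_addv f x y : f (x + y) = f x + f y :> R.
Proof. exact: linearD. Qed.

Lemma dual_subv f x y : f (x - y) = f x - f y :> R.
Proof. exact: linearB. Qed.

Lemma dual_oppv f x : f (- x) = - f x :> R.
Proof. exact: linearN. Qed.

Lemma dual_0v f : f 0 = 0 :> R.
Proof. exact: linear0. Qed.

Lemma dual_addE f g x : (f + g) x = f x + g x :> R.
Proof. by []. Qed.

Lemma dual_oppE f x : (- f) x = - f x :> R.
Proof. by []. Qed.

Lemma dual_scalE (a : R) f x : (a *: f) x = a * f x :> R.
Proof. by []. Qed.

Lemma dual_le f x : (f x : R) <= `|f| * `|x|.
Proof. exact: le_trans (ler_norm _) (dual_norm_bound f x). Qed.

Lemma dual_ge f x : - (`|f| * `|x|) <= (f x : R).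
Proof. by have := dual_le f (- x); rewrite dual_oppv normrN; lra. Qed.

Lemma dual_norm_leP f (M : R) : 0 <= M ->
  (forall x, (f x : R) <= M * `|x|) -> `|f| <= M.
Proof.
move=> M0 fM; apply: dual_norm_le => x x1; rewrite ler_norml.
have := fM x; have := fM (- x); rewrite dual_oppv normrN => h1 h2.
have : M * `|x| <= M by rewrite -[leRHS]mulr1 ler_wpM2l.
by move=> h3; apply/andP; split; lra.
Qed.

Lemma dual_approx_norm f (c : R) : c < `|f| ->
  exists2 x, `|x| <= 1 & c < (f x : R).
Proof.
move=> cf; have [s0 s1] := dual_has_sup f.
have e0 : 0 < `|f| - c by rewrite subr_gt0.
have [_ [x /= x1 <-]] := sup_adherent e0 (conj s0 s1).
rewrite -/(dual_norm f) -[dual_norm f]/(`|f|) => fx.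
have {}fx : c < `|f x : R| by lra.
have [f0|f0] := leP 0 (f x : R).
  by exists x => //; rewrite ger0_norm in fx.
by exists (- x); rewrite ?normrN// dual_oppv; rewrite ltr0_norm in fx.
Qed.

Lemma dual_of_bounded (f : V -> R) (K : R) :
  linear (f : V -> R^o) -> (forall x, f x <= K * `|x|) -> 0 <= K ->
  exists2 g : dual V, (forall x, g x = f x :> R) & `|g| <= K.
Proof.
move=> lf fK K0.
pose L : {linear V -> R^o} := HB.pack f (GRing.isLinear.Build R V R^o _ f lf).
have fN x : `|f x| <= K * `|x|.
  rewrite ler_norml fK andbT; have := fK (- x); rewrite normrN.
  by rewrite -[f (- x)]/(L (- x)) linearN -[L x]/(f x) /=; lra.
have cf : continuous (f : V -> R^o).
  apply/(@linear_bounded_continuous _ _ _ L).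
  apply/bounded_funP => r; exists (K * r) => x xr.
  by apply: le_trans (fN x) _; rewrite ler_wpM2l.
have df : (f : V -> R^o) \in @dual_pred R V by rewrite inE.
by exists (Dual df) => //; apply: dual_norm_leP.
Qed.

End dual_theory.

Section convex_sandwich.
Context (R : realType) (V : normedModType R).
Implicit Types (f g chi : V -> R) (K : R) (C : set (V * R)).

Definition convex_fun f := forall x y (t : R), 0 <= t -> t <= 1 ->
  f (t *: x + (1 - t) *: y) <= t * f x + (1 - t) * f y.

(** Exchanging [x] and [y] gives the usual two-sided bound. *)
Definition lipschitz_fun K f := forall x y, f x - f y <= K * `|x - y|.

(** An element [(v, t)] encodes the demand that a functional be at least [t] at [v]. *)
Definition convex_cone C := [/\ C (0, 0),
  (forall u v, C u -> C v -> C (u + v)) &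
  (forall (a : R) u, 0 < a -> C u -> C (a *: u.1, a * u.2))].

(* The separating functional is found below the sublinear function
   [h |-> inf (chi (s (h + v)) / s - t)] over [s > 0] and [(v, t)] in [C]. *)
Lemma convex_cone_sandwich chi K C : convex_fun chi -> lipschitz_fun K chi ->
  0 <= K -> convex_cone C -> (forall u, C u -> u.2 <= chi u.1) ->
  exists p : dual V, [/\ forall h, (p h : R) <= chi h,
    forall u, C u -> u.2 <= (p u.1 : R) & `|p| <= K].
Proof.
move=> cchi lchi K0 [C0 CD CZ] chiC.
pose E h := [set x | exists (s : R) u, [/\ 0 < s, C u &
  x = s^-1 * chi (s *: (h + u.1)) - u.2]].
have Elb h : lbound (E h) (- (K * `|h|)).
  move=> _ [s [u [s0 Cu ->]]].
  have h1 : s * u.2 <= chi (s *: u.1) by have := chiC _ (CZ _ _ s0 Cu).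
  have := lchi (s *: u.1) (s *: (h + u.1)); rewrite -scalerBr opprD.
  rewrite addrCA subrr addr0 normrZ normrN gtr0_norm// => h2.
  have : u.2 - K * `|h| <= s^-1 * chi (s *: (h + u.1)).
    by rewrite ler_pdivlMl//; lra.
  lra.
have E0 h : E h !=set0 by eexists; exists 1, (0, 0); split.
pose P h := inf (E h).
have Ple h s u : 0 < s -> C u -> P h <= s^-1 * chi (s *: (h + u.1)) - u.2.
  by move=> s0 Cu; apply: inf_le (Elb h) _; exists s, u.
have Pchi h : P h <= chi h.
  have := Ple h 1 (0, 0) ltr01 C0.
  by rewrite /= addr0 scale1r invr1 mul1r subr0.
have sP : sublinear P.
  apply: sublinear_scale_le => [x y|a x a0]; last first.
    rewrite -ler_pdivrMl//; apply: lb_le_inf => // _ [s [u [s0 Cu ->]]].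
    rewrite ler_pdivrMl//.
    have := Ple (a *: x) (a^-1 * s) (a *: u.1, a * u.2).
    rewrite mulr_gt0 ?invr_gt0// => /(_ isT (CZ _ _ a0 Cu))/=.
    rewrite -scalerDr scalerA mulrAC mulVf ?gt_eqF// mul1r.
    by rewrite invfM invrK; lra.
  apply: ler_addeps => e e0; have e20 : 0 < e / 2 by lra.
  have [_ [s [u [s0 Cu ->]]]] := inf_lt_adherent (E0 x) (Elb x) e20.
  have [_ [t [v [t0 Cv ->]]]] := inf_lt_adherent (E0 y) (Elb y) e20.
  rewrite -/(P x) -/(P y) => Py Px.
  have st0 : 0 < s + t by rewrite addr_gt0.
  (* Since [r = th * s = (1 - th) * t], the point with factor [r] is a convex combination of the
     points with factors [s] and [t]. *)
  pose r := s * t / (s + t); pose th := t / (s + t).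
  have r0 : 0 < r by rewrite divr_gt0// mulr_gt0.
  have th0 : 0 <= th by rewrite divr_ge0// ltW.
  have th1 : th <= 1 by rewrite ler_pdivrMr// mul1r lerDr ltW.
  have [n1 n2 n3] : [/\ s + t != 0, s != 0 & t != 0] by split; rewrite gt_eqF.
  have rs : r = th * s by rewrite /r /th; field.
  have rt : r = (1 - th) * t by rewrite /r /th; field.
  have := Ple (x + y) r (u + v) r0 (CD _ _ Cu Cv).
  have -> : r *: (x + y + (u + v).1) =
      th *: (s *: (x + u.1)) + (1 - th) *: (t *: (y + v.1)).
    by rewrite !scalerA -rs -rt -scalerDr addrACA.
  have := cchi (s *: (x + u.1)) (t *: (y + v.1)) _ th0 th1.
  move: (chi (s *: (x + u.1))) Px (chi (t *: (y + v.1))) Py (chi _).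
  move=> a Px b Py c cab /= Pc.
  have : r^-1 * c <= s^-1 * a + t^-1 * b.
    rewrite ler_pdivrMl// (le_trans cab)//.
    have -> // : r * (s^-1 * a + t^-1 * b) = th * a + (1 - th) * b.
    by rewrite /r /th; field; rewrite n1 n2 n3.
  lra.
have [f lf fP] := hahn_banach sP.
have c0 : 0 <= chi 0 by have := chiC _ C0.
(* [chi 0] may be positive; its contribution is divided by an arbitrarily large [s]. *)
have small (e : R) : 0 < e -> exists2 s : R, 0 < s & s^-1 * chi 0 <= e.
  move=> e0; have c1 : 0 < chi 0 + 1 by lra.
  exists ((chi 0 + 1) / e); first exact: divr_gt0.
  rewrite invf_div mulrAC ler_pdivrMr// ler_pM2l//; lra.
have fZ (s : R) x : f (s *: x) = s * f x.
  have f0 : f 0 = 0 by have := lf 1 0 0; rewrite !scale1r addr0 => h; lra.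
  by have := lf s x 0; rewrite !addr0 f0 addr0.
have fK x : f x <= K * `|x|.
  apply: ler_addeps => e /small[s s0 se].
  have := le_trans (fP _) (Pchi (s *: x)); rewrite fZ => h1.
  have := lchi (s *: x) 0; rewrite subr0 normrZ gtr0_norm// => h2.
  have : f x <= s^-1 * (chi 0 + s * (K * `|x|)).
    by rewrite ler_pdivlMl//; lra.
  by rewrite mulrDr mulKf ?gt_eqF//; lra.
have [p pf pK] := dual_of_bounded lf fK K0.
exists p; split => // [h|u Cu]; first by rewrite pf (le_trans (fP h)).
rewrite pf; apply: ler_addeps => e /small[s s0 se].
have := Ple (- u.1) s u s0 Cu; rewrite addNr scaler0.
have := fP (- u.1); rewrite -scaleN1r fZ; lra.
Qed.

(** The sandwich theorem for the cone reduced to the origin, applied to the increments of [f] at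
    [x]. *)
Lemma convex_subgradient f K x : convex_fun f -> lipschitz_fun K f -> 0 <= K ->
  exists2 p : dual V, (forall h, (p h : R) <= f (x + h) - f x) & `|p| <= K.
Proof.
move=> cf lf K0.
have [|h1 h2|||u ->|p [pf _ pK]] :=
    @convex_cone_sandwich (fun h => f (x + h) - f x) K [set 0].
- move=> y z t t0 t1; have := cf (x + y) (x + z) t t0 t1.
  have t1E : t + (1 - t) = 1 by rewrite addrC subrK.
  by rewrite !scalerDr addrACA -scalerDl t1E scale1r; lra.
- have := lf (x + h1) (x + h2); rewrite opprD addrACA subrr add0r; lra.
- by [].
- split => //= [_ _ -> ->|a _ _ ->]; first by rewrite addr0.
  by rewrite scaler0 mulr0.
- by rewrite /= addr0 subrr.
- by exists p.
Qed.

End convex_sandwich.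

(** * Smooth approximation of convex functions *)

Section smooth_approximation.
Context (R : realType) (V : normedModType R).
Implicit Types (f phi psi : V -> R) (g p : dual V) (c K : R).

(** This is Frechet differentiability at [x] together with the subgradient inequality, which takes
    the place of the lower estimate. *)
Definition gradient f x p := (forall h, (p h : R) <= f (x + h) - f x) /\
  forall e : R, 0 < e -> exists2 d : R, 0 < d &
    forall h, `|h| < d -> f (x + h) - f x - (p h : R) <= e * `|h|.

Definition smooth f := forall x, exists p, gradient f x p.

Definition quad g c (y : V) : R := (g y : R) + (2 * c)^-1 * `|y| ^+ 2.

Definition infconv f g c (x : V) :=
  inf [set f (x - y) + quad g c y | y in [set: V]].

(* For [psi] the infimal convolution of [quad g c] with some function [r],
   [rho] is the value of [r] at [z]; stating the property without [r] makes it
   stable under further convolutions and decreasing limits. *)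
Definition splits psi g c := forall x (e : R), 0 < e -> exists z y (rho : R),
  [/\ z + y = x, rho + quad g c y <= psi x + e &
      forall v, psi (z + v) <= rho + quad g c v].

Lemma quad0 g c : quad g c 0 = 0.
Proof. by rewrite /quad dual_0v normr0 expr0n mulr0 addr0. Qed.

Lemma convex_norm (x y : V) (t : R) : 0 <= t -> t <= 1 ->
  `|t *: x + (1 - t) *: y| <= t * `|x| + (1 - t) * `|y|.
Proof.
move=> t0 t1; apply: le_trans (ler_normD _ _) _.
by rewrite !normrZ !ger0_norm// subr_ge0.
Qed.

Lemma quad_convex g c : 0 < c -> convex_fun (quad g c).
Proof.
move=> c0 x y t t0 t1; rewrite /quad dual_addv !dual_scaleE.
have i0 : 0 < (2 * c)^-1 by rewrite invr_gt0 mulr_gt0.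
suff : `|t *: x + (1 - t) *: y| ^+ 2 <= t * `|x| ^+ 2 + (1 - t) * `|y| ^+ 2.
  rewrite -(ler_pM2l i0); move: (`|_ + _| ^+ 2) (`|x| ^+ 2) (`|y| ^+ 2) => a b d.
  by rewrite mulrDr; lra.
have t1' : 0 <= 1 - t by rewrite subr_ge0.
have n0 : 0 <= `|x| /\ 0 <= `|y| by [].
apply: (@le_trans _ _ ((t * `|x| + (1 - t) * `|y|) ^+ 2)).
  by rewrite ler_pXn2r ?nnegrE ?convex_norm// addr_ge0 ?mulr_ge0.
have := mulr_ge0 (mulr_ge0 t0 t1') (sqr_ge0 (`|x| - `|y|)).
by rewrite !expr2; lra.
Qed.

Section infconv.
Variables (f : V -> R) (g : dual V) (c K : R).
Hypotheses (c0 : 0 < c) (lf : lipschitz_fun K f).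

Let lb x := f x - c / 2 * (K + `|g|) ^+ 2.

(** The Lipschitz bound reduces the claim to the quadratic [- (K + |g|) n + n ^ 2 / (2 c)] in
    [n = |y|], whose minimum is found by completing the square. *)
Lemma infconv_lb x y : lb x <= f (x - y) + quad g c y.
Proof.
have := lf x (x - y); rewrite subKr => h1.
have h2 := dual_ge g y.
suff : - (c / 2 * (K + `|g|) ^+ 2) <=
       - ((K + `|g|) * `|y|) + (2 * c)^-1 * `|y| ^+ 2 by rewrite /lb /quad; lra.
rewrite -subr_ge0; set a := K + _; set n := `|y|.
have -> : - (a * n) + (2 * c)^-1 * n ^+ 2 - - (c / 2 * a ^+ 2) =
    (2 * c)^-1 * (n - c * a) ^+ 2 by field; rewrite gt_eqF.
by rewrite mulr_ge0 ?sqr_ge0// invr_ge0 mulr_ge0// ltW.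
Qed.

Let E x := [set f (x - y) + quad g c y | y in [set: V]].

Let Elb x : lbound (E x) (lb x).
Proof. by move=> _ [y _ <-]; exact: infconv_lb. Qed.

Let E0 x : E x !=set0.
Proof. by eexists; exists 0. Qed.

Lemma infconv_ge x : lb x <= infconv f g c x.
Proof. by apply: lb_le_inf; [exact: E0|exact: Elb]. Qed.

Lemma infconv_le x y : infconv f g c x <= f (x - y) + quad g c y.
Proof. by apply: inf_le (@Elb x) _; exists y. Qed.

Lemma infconv_le_self x : infconv f g c x <= f x.
Proof. by have := infconv_le x 0; rewrite subr0 quad0 addr0. Qed.

Lemma infconv_adherent x (e : R) : 0 < e ->
  exists y, f (x - y) + quad g c y < infconv f g c x + e.
Proof. by move=> /(inf_lt_adherent (E0 x) (@Elb x))[_ [y _ <-]]; exists y. Qed.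

Lemma infconv_lipschitz : lipschitz_fun K (infconv f g c).
Proof.
move=> x z; suff : infconv f g c x <= infconv f g c z + K * `|x - z| by lra.
apply: ler_addeps => e /(infconv_adherent z)[y yz].
have := infconv_le x y; have := lf (x - y) (z - y).
by rewrite opprB addrA subrK; lra.
Qed.

Lemma infconv_convex : convex_fun f -> convex_fun (infconv f g c).
Proof.
move=> cf x z t t0 t1; apply: ler_addeps => e e0.
have [y yx] := infconv_adherent x e0.
have [w wz] := infconv_adherent z e0.
have := infconv_le (t *: x + (1 - t) *: z) (t *: y + (1 - t) *: w).
have := quad_convex g c0 y w t0 t1.
have := cf (x - y) (z - w) t t0 t1.
rewrite opprD addrACA -!scalerBr.
have t1' : 0 <= 1 - t by rewrite subr_ge0.
have h1 := ler_wpM2l t0 (ltW yx).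
have h2 := ler_wpM2l t1' (ltW wz).
lra.
Qed.

Lemma infconv_splits : splits (infconv f g c) g c.
Proof.
move=> x e /(infconv_adherent x)[y yx]; exists (x - y), y, (f (x - y)).
split; [by rewrite subrK|exact: ltW|] => v.
by have := infconv_le (x - y + v) v; rewrite addrK.
Qed.

(** For almost optimal [u], a decomposition of [x - u] becomes one of [x] when [z] is translated by
    [u] and [rho] raised by [quad g c u]. Later convolutions thus keep the structure created by
    earlier ones. *)
Lemma infconv_splits_stable g' c' :
  splits f g' c' -> splits (infconv f g c) g' c'.
Proof.
move=> sf x e e0; have e20 : 0 < e / 2 by lra.
have [u ux] := infconv_adherent x e20.
have [z [y [rho [zy rhoy zv]]]] := sf (x - u) _ e20.
exists (z + u), y, (rho + quad g c u); split => [||v].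
- by rewrite addrAC zy subrK.
- lra.
- have := infconv_le (z + u + v) u; rewrite [z + u + v]addrAC addrK.
  by have := zv v; lra.
Qed.

End infconv.

(** One half of the formula for the conjugate of [quad g c]: the hypothesis is tested at [c |p - g|]
    times a vector of the unit ball where [p - g] nearly attains its norm. *)
Lemma quad_conjugate g c p (B : R) : 0 < c ->
  (forall v, (p v : R) - quad g c v <= B) -> c / 2 * `|p - g| ^+ 2 <= B.
Proof.
move=> c0 pB; set a := `|p - g|.
have a0 : 0 <= a by exact: normr_ge0.
apply: ler_addeps => e e0.
have d0 : 0 < e / (c * a + 1) by rewrite divr_gt0// ltr_wpDl// mulr_ge0// ltW.
have [|v v1] := @dual_approx_norm _ _ (p - g) (a - e / (c * a + 1)).
  by rewrite gtrBl.
rewrite dual_addE dual_oppE => av.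
have := pB ((c * a) *: v); rewrite /quad !dual_scaleE normrZ.
rewrite ger0_norm; last by rewrite mulr_ge0// ltW.
move=> h.
have h1 : c * a * (a - e / (c * a + 1)) <= c * a * ((p v : R) - g v).
  by rewrite ler_wpM2l ?(ltW av)// mulr_ge0// ltW.
have h2 : c * a * (e / (c * a + 1)) <= e.
  rewrite mulrA ler_pdivrMr ?ltr_wpDl ?mulr_ge0 ?(ltW c0)//.
  by rewrite mulrDr mulr1; lra.
have h3 : (2 * c)^-1 * (c * a * `|v|) ^+ 2 <= c / 2 * a ^+ 2.
  have -> : (2 * c)^-1 * (c * a * `|v|) ^+ 2 = c / 2 * a ^+ 2 * `|v| ^+ 2.
    by field; rewrite gt_eqF.
  rewrite ler_piMr ?exprn_ile1//.
  by rewrite mulr_ge0 ?sqr_ge0// divr_ge0// ltW.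
by rewrite !expr2 in h h3 *; lra.
Qed.

(* Halfway between the two subgradients the conjugate of [quad g c], which is
   [c / 2 * `|p - g| ^+ 2], is strictly below the average of its values. *)
Lemma subgradient_gap psi g c x h p p' : 0 < c -> splits psi g c ->
  (forall v, (p v : R) <= psi (x + v) - psi x) ->
  (forall v, (p' v : R) <= psi (x + h + v) - psi (x + h)) ->
  c / 8 * (`|p - g| - `|p' - g|) ^+ 2 <=
    (psi x - psi (x + h) + (p' h : R)) / 2.
Proof.
move=> c0 spsi px px'; apply: ler_addeps => e e0.
have [z [y [rho [zyx rhoy zv]]]] := spsi x e e0.
have hp : c / 2 * `|p - g| ^+ 2 <= rho - psi x + p y.
  apply: quad_conjugate => // v; have := px (v - y).
  rewrite dual_subv; have -> : x + (v - y) = z + v.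
    by rewrite -zyx addrACA subrr addr0.
  by have := zv v; lra.
have hp' : c / 2 * `|p' - g| ^+ 2 <= rho - psi (x + h) + p' y + p' h.
  apply: quad_conjugate => // v; have := px' (v - y - h).
  rewrite !dual_subv.
  have -> : x + h + (v - y - h) = z + v.
    by rewrite [v - y - h]addrAC [x + h + _]addrA [x + h + _]addrACA subrr
      addr0 -zyx [z + y + v]addrAC addrK.
  by have := zv v; lra.
have h1 := dual_le (p - g) y; have h2 := dual_le (p' - g) y.
rewrite !dual_addE !dual_oppE in h1 h2.
move: rhoy; rewrite /quad => rhoy.
set a := `|p - g| in hp h1 *; set b := `|p' - g| in hp' h2 *.
set n := `|y| in rhoy h1 h2 *.
have h3 : (a + b) / 2 * n - (2 * c)^-1 * n ^+ 2 <= c / 8 * (a + b) ^+ 2.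
  rewrite -subr_ge0.
  have -> : c / 8 * (a + b) ^+ 2 - ((a + b) / 2 * n - (2 * c)^-1 * n ^+ 2) =
    (2 * c)^-1 * (n - c * (a + b) / 2) ^+ 2 by field; rewrite gt_eqF.
  by rewrite mulr_ge0 ?sqr_ge0// invr_ge0 mulr_ge0// ltW.
rewrite !expr2 in hp hp' h3 rhoy *; lra.
Qed.

(** Let [p] be a subgradient at [x] and choose [g n] close to [p]. For small [h] the gap estimate
    forces each subgradient [p'] at [x + h] to be almost as close to [g n], hence close to [p], and
    the error of the linear approximation is at most [(p' - p) h]. *)
Lemma splits_smooth psi K (g : nat -> dual V) (c : nat -> R) :
  convex_fun psi -> lipschitz_fun K psi -> 0 <= K -> (forall n, 0 < c n) ->
  (forall p (e : R), 0 < e -> exists n, `|p - g n| < e) ->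
  (forall n, splits psi (g n) (c n)) -> smooth psi.
Proof.
move=> cpsi lpsi K0 c0 dg spsi x.
have [p px _] := convex_subgradient x cpsi lpsi K0.
exists p; split => // e e0; have e30 : 0 < e / 3 by lra.
have [n pn] := dg p _ e30; have cn := c0 n.
have K1 : 0 < 8 * (K + 1) by lra.
(* The right side of the gap estimate is at most [K |h|]; on this radius it stays below
   [c n / 8 * (e / 3) ^ 2]. *)
exists (c n * (e / 3) ^+ 2 / (8 * (K + 1))).
  by rewrite divr_gt0// mulr_gt0// exprn_gt0.
move=> h; rewrite ltr_pdivlMr// => hd.
have [p' px' pK'] := convex_subgradient (x + h) cpsi lpsi K0.
have gap := subgradient_gap cn (spsi n) px px'.
have lxh := lpsi x (x + h); rewrite opprD addrA subrr add0r normrN in lxh.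
have ph : (p' h : R) <= K * `|h|.
  by apply: le_trans (dual_le _ _) _; rewrite ler_wpM2r.
have h0 : 0 <= `|h| by [].
set a := `|p - g n| in pn gap; set b := `|p' - g n| in gap.
have ba : b < a + e / 3.
  rewrite ltNge; apply/negP => ab.
  have : (e / 3) ^+ 2 <= (a - b) ^+ 2.
    rewrite -[leRHS]sqrrN opprB ler_pXn2r ?nnegrE//; lra.
  move=> /(ler_wpM2l (ltW cn)); lra.
have : `|p' - p| <= e.
  rewrite -(subrK (g n) p') -addrA; apply: le_trans (ler_normD _ _) _.
  rewrite -/b distrC -/a; lra.
move=> /(ler_wpM2r h0); apply: le_trans.
apply: le_trans (dual_le _ _); rewrite dual_addE dual_oppE.
have := px' (- h); rewrite dual_oppv addrK; lra.
Qed.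

(** Stage [n] convolves with [quad (g n) (c n)]. The stages decrease to a limit that splits off
    every one of these quadratics, so that it is smooth by [splits_smooth]. *)
Lemma smooth_approx phi K (tau : R) (g : nat -> dual V) :
  convex_fun phi -> lipschitz_fun K phi -> 0 <= K -> 0 < tau ->
  (forall p (e : R), 0 < e -> exists n, `|p - g n| < e) ->
  exists psi, [/\ lipschitz_fun K psi, smooth psi &
    forall x, phi x - tau <= psi x <= phi x].
Proof.
move=> cphi lphi K0 tau0 dg.
pose a n := 1 + K + `|g n|.
have a1 n : 1 <= a n by rewrite /a -addrA lerDl addr_ge0.
have a0 n : 0 < a n by rewrite (lt_le_trans ltr01).
(* As [a n] exceeds [K + |g n|], stage [n] lowers the function by at most [tau / 2 ^ (n + 1)], and
   the total loss is at most [tau]. *)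
pose c n := tau * 2^-1 ^+ n / a n ^+ 2.
have i2 n : 0 < (2^-1 : R) ^+ n by rewrite exprn_gt0.
have c0 n : 0 < c n.
  by rewrite divr_gt0 ?exprn_gt0// mulr_gt0.
pose f := fix f n := if n is m.+1 then infconv (f m) (g m) (c m) else phi.
have fl n : lipschitz_fun K (f n).
  by elim: n => //= n; exact: infconv_lipschitz.
have fc n : convex_fun (f n).
  by elim: n => //= n; apply: infconv_convex.
have fdec n m x : (n <= m)%N -> f m x <= f n x.
  elim: m => [|m IH]; first by rewrite leqn0 => /eqP->.
  rewrite leq_eqVlt => /predU1P[->//|/IH]; apply: le_trans.
  exact: infconv_le_self.
have flb n x : phi x - tau * (1 - 2^-1 ^+ n) <= f n x.
  elim: n => [|n IH]; first by rewrite subrr mulr0 subr0.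
  apply: le_trans (infconv_ge (g n) (c0 n) (fl n) x).
  suff : c n / 2 * (K + `|g n|) ^+ 2 <= tau * 2^-1 ^+ n / 2.
    rewrite [2^-1 ^+ n.+1]exprS; lra.
  suff : c n * (K + `|g n|) ^+ 2 <= tau * 2^-1 ^+ n by lra.
  rewrite /c mulrAC ler_pdivrMr ?exprn_gt0// ler_pM2l ?mulr_gt0//.
  by rewrite ler_pXn2r ?nnegrE ?addr_ge0 ?(ltW (a0 n))// /a -addrA lerDr.
pose E x := [set f n x | n in [set: nat]].
have Elb x : lbound (E x) (phi x - tau).
  by move=> _ [n _ <-]; apply: le_trans (flb n x); have := mulr_gt0 tau0 (i2 n); lra.
have E0 x : E x !=set0 by exists (f 0 x), 0.
pose psi x := inf (E x).
have psile n x : psi x <= f n x by apply: inf_le (Elb x) _; exists n.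
have psiad x e n : 0 < e -> exists2 m, (n <= m)%N & f m x < psi x + e.
  move=> /(inf_lt_adherent (E0 x) (Elb x))[_ [m _ <-]] fm.
  exists (maxn n m); first exact: leq_maxl.
  by apply: le_lt_trans fm; apply: fdec; exact: leq_maxr.
have lpsi : lipschitz_fun K psi.
  move=> x z; suff : psi x <= psi z + K * `|x - z| by lra.
  apply: ler_addeps => e /(psiad z _ 0)[m _ fm].
  have := psile m x; have := fl m x z; lra.
exists psi; split => //; last first.
  by move=> x; rewrite (psile 0)/= andbT; exact: lb_le_inf.
apply: (splits_smooth (K := K) (c := c)) dg _ => // [x z t t0 t1|n x e e0].
  apply: ler_addeps => e e0.
  have [m _ fm] := psiad x e 0 e0; have [m' mm' fm'] := psiad z e m e0.
  have := fc m' x z t t0 t1; have := psile m' (t *: x + (1 - t) *: z).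
  have t1' : 0 <= 1 - t by rewrite subr_ge0.
  have h1 := ler_wpM2l t0 (ltW (le_lt_trans (fdec _ _ x mm') fm)).
  have h2 := ler_wpM2l t1' (ltW fm').
  lra.
have fs m : (n < m)%N -> splits (f m) (g n) (c n).
  elim: m => // m IH; rewrite ltnS leq_eqVlt => /predU1P[<-|/IH].
    exact: infconv_splits.
  exact: infconv_splits_stable.
have e20 : 0 < e / 2 by lra.
have [m nm fm] := psiad x _ n.+1 e20.
have [z [y [rho [zy rhoy zv]]]] := fs m nm x _ e20.
exists z, y, rho; split => // [|v]; first lra.
exact: le_trans (psile m _) (zv v).
Qed.

End smooth_approximation.

(** * Completeness and the variational principle *)

Section geometric_completeness.
Context (R : realType).

Lemma half_pow_small (c e : R) : 0 < e ->
  exists k, forall j, (k <= j)%N -> c * 2^-1 ^+ j < e.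
Proof.
move=> e0; exists (Num.bound (c / e)) => j kj.
have [c0|c0] := leP c 0.
  by apply: le_lt_trans e0; rewrite mulr_le0_ge0// exprn_ge0.
rewrite exprVn ltr_pdivrMr ?exprn_gt0// -ltr_pdivrMl// mulrC.
apply: lt_le_trans (_ : (Num.bound (c / e))%:R <= _).
  by rewrite archi_boundP// divr_ge0// ltW.
by rewrite -natrX ler_nat (leq_trans kj)// ltnW// ltn_expl.
Qed.

(** Completeness as a predicate with an explicit rate; it passes to products, to duals and to closed
    subspaces. *)
Definition geo_complete (V : normedModType R) := forall (u : nat -> V) (c : R),
  (forall k, `|u k.+1 - u k| <= c * 2^-1 ^+ k) ->
  exists l, forall k, `|u k - l| <= 2 * c * 2^-1 ^+ k.

Lemma geo_cauchy (V : normedModType R) (u : nat -> V) (c : R) :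
  (forall k, `|u k.+1 - u k| <= c * 2^-1 ^+ k) ->
  forall k j, (k <= j)%N -> `|u k - u j| <= 2 * c * 2^-1 ^+ k.
Proof.
move=> uc k j kj.
have c0 : 0 <= c by have := le_trans (normr_ge0 _) (uc 0%N); rewrite mulr1.
suff : `|u k - u j| <= 2 * c * (2^-1 ^+ k - 2^-1 ^+ j).
  by move=> /le_trans; apply; rewrite ler_wpM2l ?mulr_ge0// gerBl exprn_ge0.
elim: j kj => [|j IH]; first by rewrite leqn0 => /eqP->; rewrite !subrr normr0 mulr0.
rewrite leq_eqVlt => /predU1P[->|/IH h]; first by rewrite !subrr normr0 mulr0.
rewrite -(subrK (u j) (u k)) -addrA; apply: le_trans (ler_normD _ _) _.
have := uc j; rewrite distrC [2^-1 ^+ j.+1]exprS; lra.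
Qed.

Lemma banach_geo_complete (V : completeNormedModType R) : geo_complete V.
Proof.
move=> u c uc; have uC := geo_cauchy uc.
have : cvg (u @ \oo).
  apply: cauchy_cvg; apply/cauchyP => e e0.
  have [k kP] := half_pow_small (2 * c) e0; exists (u k).
  suff : \forall j \near \oo, ball (u k) e (u j) by [].
  near=> j; rewrite -ball_normE /=.
  apply: le_lt_trans (kP k (leqnn k)); apply: uC.
  by near: j; exact: nbhs_infty_ge.
move=> /cvg_ex[l ul]; exists l => k.
apply: ler_addeps => e e0.
have : \forall j \near \oo, `|u k - l| <= 2 * c * 2^-1 ^+ k + e.
  near=> j.
  have h1 : `|u k - u j| <= 2 * c * 2^-1 ^+ k.
    by apply: uC; near: j; exact: nbhs_infty_ge.
  have h2 : `|l - u j| <= e by near: j; move/cvgrPdist_le: ul; exact.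
  by rewrite -(subrK (u j) (u k)) -addrA (le_trans (ler_normD _ _))// lerD// distrC.
by case=> N _ /(_ N); apply => /=.
Unshelve. all: by end_near. Qed.

Lemma prod_geo_complete (V W : normedModType R) :
  geo_complete V -> geo_complete W -> geo_complete (V * W)%type.
Proof.
move=> cV cW u c uc.
have [|l lP] := cV (fst \o u) c.
  by move=> k; apply: le_trans (uc k); rewrite prod_normE le_max lexx.
have [|m mP] := cW (snd \o u) c.
  by move=> k; apply: le_trans (uc k); rewrite prod_normE le_max lexx orbT.
by exists (l, m) => k; rewrite prod_normE ge_max lP mP.
Qed.

(** The limit is taken pointwise. Linearity passes to it, and the pointwise rate, being proportional
    to [|x|], yields both its boundedness and the rate in the dual norm. *)
Lemma dual_geo_complete (V : normedModType R) : geo_complete (dual V).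
Proof.
move=> u c uc.
have /choice[l lP] x : exists l : R, forall k,
    `|(u k x : R) - l| <= 2 * (c * `|x|) * 2^-1 ^+ k.
  apply: (@banach_geo_complete R^o (fun k => u k x : R) (c * `|x|)) => k.
  have -> : (u k.+1 x : R) - (u k x : R) = (u k.+1 - u k) x by [].
  rewrite mulrAC; apply: le_trans (dual_norm_bound _ _) _.
  by rewrite ler_wpM2r// uc.
have c0 : 0 <= c by have := le_trans (normr_ge0 _) (uc 0%N); rewrite mulr1.
have lin : linear (l : V -> R^o).
  move=> a x y; apply/eqP; rewrite -subr_eq0 -normr_eq0 eq_le normr_ge0 andbT.
  pose M := 2 * (c * `|a *: x + y|) + `|a| * (2 * (c * `|x|)) + 2 * (c * `|y|).
  apply: ler_addeps => e /(half_pow_small M)[k /(_ k (leqnn k)) kM].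
  rewrite add0r; apply: le_trans (ltW kM).
  have -> : l (a *: x + y) - (a *: (l x : R^o) + l y) =
     - ((u k (a *: x + y) : R) - l (a *: x + y)) +
     (a * ((u k x : R) - l x)) + ((u k y : R) - l y).
    rewrite dual_addv dual_scaleE -[a *: (l x : R^o)]/(a * l x).
    move: (u k x : R) (u k y : R) => ux uy; ring.
  have h1 := lP (a *: x + y) k; have h2 := ler_wpM2l (normr_ge0 a) (lP x k).
  have h3 := lP y k; rewrite -normrM in h2.
  apply: le_trans (ler_normD _ _) _; rewrite /M !mulrDl.
  have := ler_normD (- ((u k (a *: x + y) : R) - l (a *: x + y)))
    (a * ((u k x : R) - l x)).
  rewrite normrN; lra.
have [||p pl pM] := @dual_of_bounded _ _ l (`|u 0%N| + 2 * c) lin.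
- move=> x; have := lP x 0%N; rewrite mulr1 ler_distlC => /andP[_ h].
  by have := dual_le (u 0%N) x; rewrite mulrDl; lra.
- by rewrite addr_ge0 ?mulr_ge0.
exists p => k; apply: dual_norm_leP => [|x].
  by rewrite !mulr_ge0// exprn_ge0.
rewrite dual_addE dual_oppE pl; apply: le_trans (ler_norm _) _.
by have := lP x k; lra.
Qed.

Lemma closed_limit (V : normedModType R) (S : set V) (l : V) : closed S ->
  (forall e : R, 0 < e -> exists2 s, S s & `|s - l| < e) -> S l.
Proof.
move=> cS h; apply: cS => B /nbhs_ballP[e /= e0 eB].
have [s Ss sl] := h e e0; exists s; split => //; apply: eB.
by rewrite -ball_normE /= distrC.
Qed.

End geometric_completeness.

Section variational_principle.
Context (R : realType) (V : normedModType R).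
Implicit Types (f phi psi : V -> R) (g p : dual V) (K : R).

Lemma lipschitz_norm : lipschitz_fun 1 (fun x : V => `|x|).
Proof. by move=> x y; rewrite mul1r lerB_dist. Qed.

(* The Borwein-Preiss scheme with first-order gauges [q k], approximations of
   the norm. With [q k] the norm itself and [k = 0] in the conclusion this is
   Ekeland's principle. *)
Lemma variational_principle (Q : (V -> R) -> Prop) f K S w0 (d mu : R) :
  geo_complete V -> closed S -> lipschitz_fun K f -> 0 <= K -> S w0 ->
  0 < d -> 0 < mu -> (forall y, S y -> f w0 <= f y + d) ->
  (forall tau : R, 0 < tau -> exists q, [/\ Q q, lipschitz_fun 1 q &
     forall x, `|x| - tau <= q x <= `|x|]) ->
  exists w (q : nat -> V -> R) (c : nat -> V),
    [/\ S w, `|w - w0| <= 6 * (d / mu),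
        forall k, Q (q k) /\ lipschitz_fun 1 (q k) &
        forall k y, S y ->
          f w + \sum_(i < k) mu * 2^-1 ^+ i * q i (w - c i) <=
          f y + \sum_(i < k) mu * 2^-1 ^+ i * q i (y - c i) +
            2 * mu * 2^-1 ^+ k * `|y - w|].
Proof.
move=> cV clS lf K0 Sw0 d0 mu0 fw0 gauge.
have i2 n : 0 < (2^-1 : R) ^+ n by rewrite exprn_gt0.
pose inv (k : nat) (s : (V -> R) * V) :=
  S s.2 /\ forall y, S y -> s.1 s.2 <= s.1 y + d * 2^-1 ^+ k * 2^-1 ^+ k.
pose next (k : nat) (s : (V -> R) * V) (r : (V -> R) * V) :=
  (fun y => s.1 y + mu * 2^-1 ^+ k * r.1 (y - s.2), r.2).
have /choice[g gP] (x : nat * ((V -> R) * V)) : exists r : (V -> R) * V,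
    inv x.1 x.2 -> [/\ Q r.1, lipschitz_fun 1 r.1,
      inv x.1.+1 (next x.1 x.2 r) &
      `|r.2 - x.2.2| <= 3 * (d / mu) * 2^-1 ^+ x.1].
  case: x => k [F w]; have [[/= Sw Fw]|ninv] := pselect (inv k (F, w)); last first.
    by exists (F, w).
  have mk : 0 < mu * 2^-1 ^+ k by rewrite mulr_gt0.
  (* With this accuracy the weighted error of the gauge is exactly the current tolerance [D]. *)
  have tau0 : 0 < d / mu * 2^-1 ^+ k by rewrite mulr_gt0// divr_gt0.
  have [q [Qq lq qn]] := gauge _ tau0.
  pose G y := F y + mu * 2^-1 ^+ k * q (y - w).
  pose E := [set G y | y in S].
  pose D := d * 2^-1 ^+ k * 2^-1 ^+ k.
  have {}Fw y : S y -> F w <= F y + D := Fw y.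
  have mt : mu * 2^-1 ^+ k * (d / mu * 2^-1 ^+ k) = D.
    by rewrite /D; field; rewrite gt_eqF.
  have dk : 0 < d * 2^-1 ^+ k.+1 * 2^-1 ^+ k.+1 by rewrite !mulr_gt0.
  have Elb : lbound E (F w - D - D).
    move=> _ [y Sy <-]; rewrite /G -[X in _ - X]mt.
    have /andP[h _] := qn (y - w).
    have : mu * 2^-1 ^+ k * - (d / mu * 2^-1 ^+ k) <= mu * 2^-1 ^+ k * q (y - w).
      by rewrite ler_pM2l//; apply: le_trans h; rewrite lerDr.
    have := Fw y Sy; lra.
  have Glb y : S y -> inf E <= G y by move=> Sy; apply: inf_le Elb _; exists y.
  have E0 : E !=set0 by exists (G w), w.
  have [_ [w' Sw' <-] w'G] := inf_lt_adherent E0 Elb dk.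
  exists (q, w') => _; split => //=; first split => //= y Sy.
    by have := Glb y Sy; rewrite -/(G y) -/(G w'); lra.
  (* [w'] is within [D / 4] of minimal for [G], [w] is within [D] of minimal for [F], and the gauge
     errs by at most [D]; this bounds the weighted distance by [3 D]. *)
  rewrite -(ler_pM2l mk).
  have := Glb w Sw; rewrite /G subrr in w'G *.
  have /andP[h _] := qn (w' - w).
  have /andP[_ q0] := qn 0; rewrite normr0 in q0.
  have {}q0 := ler_wpM2l (ltW mk) q0; rewrite mulr0 in q0.
  have {}h := ler_wpM2l (ltW mk) h; rewrite mulrBr mt in h.
  have := Fw w' Sw'.
  have -> : mu * 2^-1 ^+ k * (3 * (d / mu) * 2^-1 ^+ k) = 3 * D by rewrite -mt; lra.
  have dkE : d * 2^-1 ^+ k.+1 * 2^-1 ^+ k.+1 = D / 4 by rewrite /D !exprS; field.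
  rewrite dkE in w'G.
  lra.
pose st := fix st k := if k is m.+1 then next m (st m) (g (m, st m)) else (f, w0).
have st_inv k : inv k (st k).
  elim: k => [|k IH] /=; last by have [] := gP (k, st k) IH.
  by split => //= y Sy; rewrite !mulr1; exact: fw0.
pose q k := (g (k, st k)).1; pose c k := (st k).2.
have stP k : [/\ Q (q k), lipschitz_fun 1 (q k) &
    `|c k.+1 - c k| <= 3 * (d / mu) * 2^-1 ^+ k].
  by have [] := gP (k, st k) (st_inv k).
have stS k y : (st k.+1).1 y = (st k).1 y + mu * 2^-1 ^+ k * q k (y - c k) by [].
have stE k y : (st k).1 y = f y + \sum_(i < k) mu * 2^-1 ^+ i * q i (y - c i).
  elim: k => [|k IH]; first by rewrite big_ord0 addr0.
  by rewrite stS IH big_ord_recr /= addrA.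
have [|w wP] := cV c (3 * (d / mu)); first by move=> k; have [] := stP k.
have cw (e : R) : 0 < e -> exists k, forall j, (k <= j)%N -> `|c j - w| < e.
  move=> /(half_pow_small (2 * (3 * (d / mu))))[k kP]; exists k => j kj.
  exact: le_lt_trans (wP j) (kP j kj).
(* The gauges are 1-Lipschitz, so the terms from [k] to [j - 1] contribute at most the geometric sum
   of their weights. *)
have diff k j x y : (k <= j)%N -> (st k).1 x - (st k).1 y <=
    (st j).1 x - (st j).1 y + 2 * mu * (2^-1 ^+ k - 2^-1 ^+ j) * `|x - y|.
  elim: j => [|j IH]; first by rewrite leqn0 => /eqP->; rewrite subrr mulr0 mul0r addr0.
  rewrite leq_eqVlt => /predU1P[->|/IH h].
    by rewrite subrr mulr0 mul0r addr0.
  rewrite !stS; have [_ /(_ (y - c j) (x - c j)) + _] := stP j.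
  rewrite opprB addrA subrK distrC mul1r => hq.
  have mj : 0 < mu * 2^-1 ^+ j by rewrite mulr_gt0.
  have := ler_wpM2l (ltW mj) hq; rewrite [2^-1 ^+ j.+1]exprS.
  move: (2^-1 ^+ j) (q j _) (q j _) (`|x - y|) h => a b b' n.
  lra.
have lst k : lipschitz_fun (K + 2 * mu) (st k).1.
  move=> x y; suff : (st k).1 x - (st k).1 y <=
      (K + 2 * mu * (1 - 2^-1 ^+ k)) * `|x - y|.
    move=> /le_trans; apply; rewrite ler_wpM2r// lerD2l.
    by apply: ler_piMr; [rewrite mulr_ge0// ltW|rewrite gerBl ltW].
  elim: k => [|k IH]; first by rewrite subrr mulr0 addr0; exact: lf.
  rewrite !stS; have [_ /(_ (x - c k) (y - c k)) + _] := stP k.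
  rewrite opprB addrA subrK mul1r => hq.
  have mk : 0 < mu * 2^-1 ^+ k by rewrite mulr_gt0.
  have := ler_wpM2l (ltW mk) hq; rewrite [2^-1 ^+ k.+1]exprS.
  move: (2^-1 ^+ k) (q k _) (q k _) (`|x - y|) IH => a b b' n.
  lra.
exists w, q, c; split => //.
- apply: closed_limit clS _ => e /cw[k /(_ k (leqnn k)) ck].
  by exists (c k) => //; have [] := st_inv k.
- by rewrite distrC; have := wP 0%N; rewrite mulr1 mulrA -[2 * 3]natrM.
- by move=> k; have [] := stP k.
move=> k y Sy; rewrite -!stE.
apply: ler_addeps => e e0.
(* The estimate is made at [c j] and carried over to [w]. The constant [L] collects the Lipschitz
   constant of the perturbed function and the triangle inequality in the last term; for large [j]
   all errors together are below [e]. *)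
pose L := K + 2 * mu + 2 * mu.
have [j0 j0P] := half_pow_small (d + L * (2 * (3 * (d / mu)))) e0.
pose j := maxn j0 k; have kj : (k <= j)%N := leq_maxr _ _.
have := j0P j (leq_maxl _ _); rewrite mulrDl -mulrA => je.
have L0 : 0 <= L by rewrite !addr_ge0// ltW// mulr_gt0.
have h1 := ler_wpM2l L0 (wP j).
have h2 := lst k w (c j); rewrite distrC in h2.
have h3 := diff k j (c j) y kj.
have [_ /(_ y Sy) h4] := st_inv j; rewrite -/(c j) in h4.
have h5 : d * 2^-1 ^+ j * 2^-1 ^+ j <= d * 2^-1 ^+ j.
  rewrite ler_piMr ?mulr_ge0 ?(ltW d0) ?(ltW (i2 j))//.
  by rewrite exprn_ile1// invf_le1// ler1n.
have h6 : 2 * mu * (2^-1 ^+ k - 2^-1 ^+ j) * `|c j - y| <=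
    2 * mu * 2^-1 ^+ k * `|y - w| + 2 * mu * `|c j - w|.
  have mu2 : 0 <= 2 * mu by rewrite mulr_ge0// ltW.
  have k1 : 2^-1 ^+ k <= 1 :> R by rewrite exprn_ile1// invf_le1// ler1n.
  have t1 : `|c j - y| <= `|y - w| + `|c j - w|.
    by have := ler_normD (c j - w) (w - y); rewrite addrA subrK (distrC w y); lra.
  apply: (@le_trans _ _ (2 * mu * 2^-1 ^+ k * `|c j - y|)).
    by rewrite ler_wpM2r// ler_wpM2l// gerBl ltW.
  apply: le_trans (ler_wpM2l _ t1) _; first by rewrite mulr_ge0// ltW.
  rewrite mulrDr lerD2l ler_wpM2r// ler_piMr//.
rewrite /L !mulrDl in h1 je h2 *.
lra.
Qed.

End variational_principle.

(** * The sum rule when the dual is separable *)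

Section frechet_fuzzy_sum.
Context (R : realType) (V : normedModType R).
Implicit Types (f phi psi q : V -> R) (g p : dual V) (K : R) (S : set V).

(** The epsilon-delta form of the upper limit; at [s = z] both sides of the inequality vanish. *)
Lemma frechet_normalP S z p : frechet_normal S z p <->
  S z /\ forall e : R, 0 < e -> exists2 d : R, 0 < d &
    forall s, S s -> `|s - z| < d -> (p (s - z) : R) <= e * `|s - z|.
Proof.
split=> -[Sz pz]; split=> //.
  move=> e e0; have : (limf_esup (fun s => (p (s - z) / `|s - z|)%:E)
      (within S z^') < e%:E)%E by apply: le_lt_trans pz _; rewrite lte_fin.
  move=> /ereal_inf_lt[_ [B SB <-]] Be.
  have /nbhs_ballP[d /= d0 dB] : nbhs z (fun s => s != z -> S s -> B s) := SB.
  exists d => // s Ss sz.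
  have [->|sz0] := eqVneq s z; first by rewrite subrr dual_0v normr0 mulr0.
  have Bs : B s by apply: dB => //; rewrite -ball_normE /= distrC.
  rewrite -ler_pdivrMr ?normr_gt0 ?subr_eq0// -lee_fin.
  by apply: le_trans (ltW Be); apply: ereal_sup_ubound; exists s.
apply/lee_addgt0Pr => e e0; rewrite add0e.
have [d d0 dP] := pz e e0.
apply: (@le_trans _ _ (ereal_sup [set (p (s - z) / `|s - z|)%:E |
  s in [set s | [/\ S s, `|s - z| < d & s != z]]])).
  apply: ereal_inf_lbound; eexists; last reflexivity.
  have : nbhs z (ball z d) by exact: nbhsx_ballx.
  apply: filterS => s; rewrite -ball_normE /= distrC => zs sz Ss.
  by split.
apply: ge_ereal_sup => _ [s [Ss sd sz] <-]; rewrite lee_fin.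
by rewrite ler_pdivrMr ?normr_gt0 ?subr_eq0//; exact: dP.
Qed.

Lemma gradient_add f f' x p p' : gradient f x p -> gradient f' x p' ->
  gradient (fun y => f y + f' y) x (p + p').
Proof.
move=> [fp1 fp2] [gp1 gp2]; split => [h|e e0].
  by rewrite dual_addE; have := fp1 h; have := gp1 h; lra.
have e20 : 0 < e / 2 by lra.
have [d d0 dP] := fp2 _ e20; have [d' d0' dP'] := gp2 _ e20.
exists (Num.min d d') => [|h]; first by rewrite lt_min d0.
rewrite lt_min dual_addE => /andP[/dP h1 /dP' h2]; lra.
Qed.

Lemma gradient_scale_shift q x c p (m : R) : 0 < m -> gradient q (x - c) p ->
  gradient (fun y => m * q (y - c)) x (m *: p).
Proof.
move=> m0 [h1 h2]; split => [h|e e0].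
  by rewrite dual_scalE [x + h - c]addrAC -mulrBr ler_pM2l.
have em : 0 < e / m by exact: divr_gt0.
have [d d0 dP] := h2 _ em; exists d => // h /dP hd.
rewrite dual_scalE [x + h - c]addrAC -!mulrBr -ler_pdivlMl// mulrA.
by rewrite [m^-1 * e]mulrC.
Qed.

Lemma gradient_norm_le f K x p : 0 <= K -> lipschitz_fun K f ->
  gradient f x p -> `|p| <= K.
Proof.
move=> K0 lf [h1 _]; apply: dual_norm_leP => // h.
apply: le_trans (h1 h) _; apply: le_trans (lf _ _) _.
by rewrite addrAC subrr add0r.
Qed.

(** The variational principle is applied to a smooth approximation of [phi] with smooth gauges. The
    function perturbed by [k] gauges has gradient [G k] at [w] and is minimal there up to a slope
    that tends to zero with [k]. Hence the limit of [- G k] is an exact Frechet normal. *)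
Lemma frechet_fuzzy_sum_separable phi K S w0 (g : nat -> dual V) (eps : R) :
  geo_complete V ->
  (forall p (e : R), 0 < e -> exists n, `|p - g n| < e) ->
  closed S -> convex_fun phi -> lipschitz_fun K phi -> 0 <= K -> S w0 ->
  (forall y, S y -> phi w0 <= phi y) -> 0 < eps ->
  exists w p, [/\ `|w - w0| < eps, frechet_normal S w p &
    forall h, - (p h : R) <= phi (w + h) - phi w + eps + eps * `|h|].
Proof.
move=> cV dg clS cphi lphi K0 Sw0 phimin eps0.
have i2 n : 0 < (2^-1 : R) ^+ n by rewrite exprn_gt0.
have e1 : 0 < 48 * (1 + eps) by lra.
(* Then the distance [6 tau / (eps / 4)] from the variational principle equals
   [eps / (2 (1 + eps))], which is below [eps]. *)
pose tau := eps * eps / (48 * (1 + eps)).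
have tau0 : 0 < tau by rewrite divr_gt0// mulr_gt0.
have tau_eps : tau <= eps.
  by rewrite ler_pdivrMr// ler_wpM2l// ?ltW//; lra.
have [psi [lpsi spsi psiphi]] := smooth_approx cphi lphi K0 tau0 dg.
have mu0 : 0 < eps / 4 by lra.
have [|t t0|w [q [c [Sw ww0 qP Fw]]]] :=
    @variational_principle _ V (@smooth R V) psi K S w0 tau (eps / 4)
      cV clS lpsi K0 Sw0 tau0 mu0.
- move=> y Sy; have /andP[_ h1] := psiphi w0; have /andP[h2 _] := psiphi y.
  by have := phimin y Sy; lra.
- have := @smooth_approx _ _ (fun x => `|x|) 1 t g _ (@lipschitz_norm R V) ler01 t0 dg.
  case=> [x y s s0 s1|u [lu su uP]]; first exact: convex_norm.
  by exists u; split.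
have /choice[l lP] k : exists l, gradient (q k) (w - c k) l.
  by have [/(_ (w - c k))] := qP k.
have l1 k : `|l k| <= 1.
  by have [_ /gradient_norm_le] := qP k; apply => //; exact: lP.
have [l0 l0P] := spsi w.
pose G k := l0 + \sum_(i < k) (eps / 4 * 2^-1 ^+ i) *: l i.
pose F k y := psi y + \sum_(i < k) eps / 4 * 2^-1 ^+ i * q i (y - c i).
have GP k : gradient (F k) w (G k).
  elim: k => [|k IH].
    rewrite /G big_ord0 addr0; have -> // : F 0%N = psi.
    by apply/funext => y; rewrite /F big_ord0 addr0.
  have -> : F k.+1 = (fun y => F k y + eps / 4 * 2^-1 ^+ k * q k (y - c k)).
    by apply/funext => y; rewrite /F big_ord_recr /= addrA.
  rewrite /G big_ord_recr /= addrA; apply: gradient_add => //.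
  by apply: gradient_scale_shift => //; rewrite mulr_gt0.
have [|p pP] := @dual_geo_complete _ V G (eps / 4).
  move=> k; have -> : G k.+1 - G k = (eps / 4 * 2^-1 ^+ k) *: l k.
    by rewrite /G big_ord_recr /= addrA [LHS]addrAC subrr add0r.
  rewrite normrZ.
  by rewrite ger0_norm ?ler_piMr// mulr_ge0// ltW.
exists w, (- p); split.
- apply: le_lt_trans ww0 _.
  have -> : 6 * (tau / (eps / 4)) = eps / (2 * (1 + eps)).
    rewrite /tau; field; rewrite !gt_eqF//; lra.
  rewrite ltr_pdivrMr; last lra.
  have := mulr_gt0 eps0 eps0; lra.
- apply/frechet_normalP; split => // e e0.
  have e30 : 0 < e / 3 by lra.
  have [k /(_ k (leqnn k)) kP] := half_pow_small eps e30.
  have [d d0 dP] := (GP k).2 _ e30; exists d => // s Ss sd.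
  have := dP (s - w) sd; have := Fw k s Ss; rewrite -/(F k w) -/(F k s).
  have := dual_le (G k - p) (s - w); have := ler_wpM2r (normr_ge0 (s - w)) (pP k).
  rewrite dual_addE !dual_oppE [w + (s - w)]addrC subrK.
  have := ler_wpM2r (normr_ge0 (s - w)) (ltW kP).
  have := mulr_ge0 (ltW e0) (normr_ge0 (s - w)).
  lra.
- move=> h; rewrite dual_oppE opprK; have := l0P.1 h.
  have := dual_le (p - G 0%N) h; have := ler_wpM2r (normr_ge0 h) (pP 0%N).
  rewrite dual_addE dual_oppE distrC /G big_ord0 addr0.
  have /andP[_ h1] := psiphi (w + h); have /andP[h2 _] := psiphi w.
  have := mulr_ge0 (ltW eps0) (normr_ge0 h).
  rewrite mulr1; lra.
Qed.

End frechet_fuzzy_sum.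

(** * Separable reduction *)

Section separable_subspaces.
Context (R : realType).

Lemma closed_limits (V : normedModType R) (S : set V) :
  (forall l, (forall e : R, 0 < e -> exists2 s, S s & `|s - l| < e) -> S l) ->
  closed S.
Proof.
move=> h l clS; apply: h => e e0.
have [|s [Ss]] := clS (ball l e); first exact: nbhsx_ballx.
by rewrite -ball_normE /= distrC; exists s.
Qed.

Definition dense_seq (V : normedModType R) (u : nat -> V) :=
  forall x (e : R), 0 < e -> exists n, `|x - u n| < e.

Lemma separableP (V : normedModType R) :
  separable V <-> exists u : nat -> V, dense_seq u.
Proof.
split=> [[D /countable_injP[f finj] dD]|[u du]].
  exists (fun n => xget 0 [set x | D x /\ f x = n]) => x e e0.
  have [||y [xy Dy]] := dD (ball x e).
  - by exists x; exact: ballxx.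
  - exact: ball_open.
  exists (f y); case: xgetP => [z _ [Dz fzy]|/(_ y)[]//].
  rewrite (finj z y) ?inE//.
  by move: xy; rewrite -ball_normE.
exists (range u); first by apply: card_image_le; exact: countableP.
move=> O [x Ox] oO.
have [e /= e0 eO] : nbhs_ball x O by apply/nbhs_ballP; exact: open_nbhs_nbhs.
have [n xn] := du x e e0; exists (u n); split; last by exists n.
by apply: eO; rewrite -ball_normE.
Qed.

(** Iterated applications of [op] are finite trees with labels in [J], of which there are countably
    many. A tree of another shape, or a number that encodes no tree, stands for [x0]. *)
Lemma countable_op_closure (T : Type) (J : countType) (op : J -> T -> T -> T)
  (x0 : T) : exists u : nat -> T, (exists n, u n = x0) /\
  forall j m n, exists k, u k = op j (u m) (u n).
Proof.
pose eval := fix eval (t : GenTree.tree J) : T :=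
  if t is GenTree.Node _ [:: GenTree.Leaf j; t1; t2]
  then op j (eval t1) (eval t2) else x0.
pose u n := if unpickle n is Some t then eval t else x0.
have uE n : exists t, u n = eval t.
  by rewrite /u; case: unpickle => [t|]; [exists t|exists (GenTree.Node 0 [::])].
exists u; split.
  exists (pickle (GenTree.Node 0 [::] : GenTree.tree J)).
  by rewrite /u pickleK.
move=> j m n; have [t1 ->] := uE m; have [t2 ->] := uE n.
by exists (pickle (GenTree.Node 0 [:: GenTree.Leaf j; t1; t2])); rewrite /u pickleK.
Qed.

(** The closure of a set stable under sums and rational multiples is a real subspace, since real
    coefficients are approximated by rational ones. *)
Lemma closed_span_of_rat (W : normedModType R) (u : nat -> W) :
  (forall m n, exists k, u k = u m + u n) ->
  (forall (q : rat) n, exists k, u k = ratr q *: u n) ->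
  exists L : submodClosed W, forall x,
    x \in L <-> forall e : R, 0 < e -> exists n, `|x - u n| < e.
Proof.
move=> uD uZ; pose P : set W := [set x | forall e, 0 < e -> exists n, `|x - u n| < e].
have h : submod_closed (mem P : {pred W}).
  split=> [|a x y]; rewrite !inE.
    move=> e e0; have [k uk] := uZ 0 0%N; exists k.
    by rewrite uk rmorph0 scale0r subrr normr0.
  move=> Px Py e e0.
  have n1 : 0 < e / (3 * (`|x| + 1)).
    by rewrite divr_gt0// mulr_gt0// ltr_wpDl.
  (* The rational [q] is chosen first, and the approximation of [x] then depends on [|q|]; each of
     the three errors is at most [e / 3]. *)
  have [q] := rat_in_itvoo (ltr_pwDr n1 (lexx a)).
  rewrite in_itv /= => /andP[aq qa].
  have n2 : 0 < e / (3 * (`|ratr q : R| + 1)).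
    by rewrite divr_gt0// mulr_gt0// ltr_wpDl.
  have e30 : 0 < e / 3 by lra.
  have [m xm] := Px _ n2; have [n yn] := Py _ e30.
  have [k uk] := uZ q m; have [k' uk'] := uD k n; exists k'.
  have -> : a *: x + y - u k' =
      (a - ratr q) *: x + ratr q *: (x - u m) + (y - u n).
    rewrite uk' uk scalerBl scalerBr opprD !addrA; congr (_ - _).
    by rewrite subrK addrAC.
  have h1 : `|(a - ratr q) *: x| <= e / 3.
    rewrite normrZ distrC gtr0_norm ?subr_gt0//.
    apply: (@le_trans _ _ (e / (3 * (`|x| + 1)) * (`|x| + 1))).
      by apply: ler_pM; rewrite ?lerDl// ?subr_ge0 ?(ltW aq)//; lra.
    by rewrite invfM mulrA mulfVK// gt_eqF// ltr_wpDl.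
  have h2 : `|ratr q *: (x - u m)| <= e / 3.
    rewrite normrZ.
    apply: (@le_trans _ _ ((`|ratr q : R| + 1) * (e / (3 * (`|ratr q : R| + 1))))).
      by apply: ler_pM; rewrite ?lerDl// ltW.
    by rewrite mulrC invfM mulrA mulfVK// gt_eqF// ltr_wpDl.
  have := ler_normD ((a - ratr q) *: x + ratr q *: (x - u m)) (y - u n).
  have := ler_normD ((a - ratr q) *: x) (ratr q *: (x - u m)).
  lra.
pose L : submodClosed W := HB.pack (mem P : {pred W})
  (GRing.isSubmodClosed.Build R W (mem P : {pred W}) h).
by exists L => x; rewrite inE.
Qed.

End separable_subspaces.

Section separable_reduction.
Context (R : realType) (W : normedModType R).
Implicit Types (phi : W -> R) (S : set W) (K eps : R).

(** The condition of [asplund] for a plain normed space, so that it can be stated for products. *)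
Definition asplund_normed := forall L : submodClosed W,
  separable (subspace_of L) -> separable (dual (subspace_of L)).

(* A list entry [((n, k), (c, s))] stands for the vector [c (s - u)], with
   weight [c |s - u| / (n + 1)], where [s] is in [S] within [1 / (k + 1)] of
   [u]. *)
Let entry := (nat * nat * (R * W))%type.

Definition comb (u : W) (o : seq entry) : W :=
  \sum_(a <- o) a.2.1 *: (a.2.2 - u).

Definition comb_weight (u : W) (o : seq entry) : R :=
  \sum_(a <- o) a.2.1 * (a.1.1.+1%:R^-1 * `|a.2.2 - u|).

Definition admissible S (u : W) (o : seq entry) := forall a, a \in o ->
  [/\ S a.2.2, 0 <= a.2.1 & `|a.2.2 - u| < a.1.2.+1%:R^-1].

Definition increment phi eps (u h : W) : R :=
  phi (u + h) - phi u + eps + eps * `|h|.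

(* By the sandwich theorem, the absence of violations with radii [k n]
   expresses that some [p] with [- p <= increment phi eps u] satisfies
   [p (s - u) <= |s - u| / (n + 1)] for [s] in [S] within [1 / (k n + 1)]. *)
Definition violation phi S eps u o :=
  admissible S u o /\ increment phi eps u (comb u o) + comb_weight u o < 0.

Lemma comb_cat u o o' : comb u (o ++ o') = comb u o + comb u o'.
Proof. exact: big_cat. Qed.

Lemma comb_weight_cat u o o' :
  comb_weight u (o ++ o') = comb_weight u o + comb_weight u o'.
Proof. exact: big_cat. Qed.

Lemma increment_convex phi eps u : convex_fun phi -> 0 < eps ->
  convex_fun (increment phi eps u).
Proof.
move=> cphi eps0 x y t t0 t1; rewrite /increment.
have t1E : t + (1 - t) = 1 by rewrite addrC subrK.
have := cphi (u + x) (u + y) t t0 t1.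
rewrite !scalerDr addrACA -scalerDl t1E scale1r.
have := ler_wpM2l (ltW eps0) (convex_norm x y t0 t1).
rewrite mulrDr; lra.
Qed.

Lemma increment_lipschitz phi K eps u : lipschitz_fun K phi -> 0 < eps ->
  lipschitz_fun (K + eps) (increment phi eps u).
Proof.
move=> lphi eps0 x y; rewrite /increment.
have := lphi (u + x) (u + y); rewrite opprD addrACA subrr add0r.
have := ler_wpM2l (ltW eps0) (@lipschitz_norm R W x y).
rewrite mul1r mulrDl; lra.
Qed.

(** Moving the base point from [u] to [u'] shifts the combination by [- c (u' - u)], where [c] is
    the sum of the coefficients. The weight changes by at most [c |u' - u|], and the two values of
    [phi] at the shifted base point account for [2 K]. *)
Lemma violation_continuous phi K eps o u u' : lipschitz_fun K phi ->
  0 <= K -> 0 < eps -> (forall a, a \in o -> 0 <= a.2.1) ->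
  increment phi eps u' (comb u' o) + comb_weight u' o <=
  increment phi eps u (comb u o) + comb_weight u o +
    (2 * K + (K + eps + 1) * \sum_(a <- o) a.2.1) * `|u' - u|.
Proof.
move=> lphi K0 eps0 o0; set c := \sum_(a <- o) a.2.1.
have cE : comb u' o - comb u o = - (c *: (u' - u)).
  rewrite /comb -sumrB /c scaler_suml -sumrN; apply: eq_bigr => a _.
  by rewrite -scalerBr -scalerN !opprB [_ + (u - _)]addrC addrA subrK.
have c0 : 0 <= c by rewrite /c big_seq sumr_ge0.
have n1 : `|comb u' o - comb u o| <= c * `|u' - u|.
  by rewrite cE normrN normrZ ger0_norm.
have w1 : comb_weight u' o <= comb_weight u o + c * `|u' - u|.
  rewrite /comb_weight /c mulr_suml -big_split /= big_seq [leRHS]big_seq.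
  apply: ler_sum => a /o0 a0; rewrite -mulrDr ler_wpM2l//.
  have i1 : a.1.1.+1%:R^-1 <= 1 :> R by rewrite invf_le1// ler1n.
  have i0 : 0 <= a.1.1.+1%:R^-1 :> R by rewrite invr_ge0.
  have h : `|a.2.2 - u'| <= `|a.2.2 - u| + `|u' - u|.
    by have := ler_normD (a.2.2 - u) (u - u'); rewrite addrA subrK (distrC u u').
  apply: le_trans (ler_wpM2l i0 h) _; rewrite mulrDr lerD2l.
  by rewrite ler_piMl.
have := increment_lipschitz u' lphi eps0 (comb u' o) (comb u o).
have := ler_wpM2l (addr_ge0 K0 (ltW eps0)) n1.
rewrite /increment.
have := lphi (u' + comb u o) (u + comb u o); rewrite opprD addrACA subrr addr0.
have := lphi u u'; rewrite distrC.
lra.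
Qed.

(** A violation rests on finitely many strict inequalities that are continuous in [u]. One list
    therefore serves a whole ball, which is what makes countably many lists sufficient. *)
Lemma violation_open phi K S eps u o : lipschitz_fun K phi -> 0 <= K ->
  0 < eps -> violation phi S eps u o ->
  exists2 d : R, 0 < d & forall u', `|u' - u| < d -> violation phi S eps u' o.
Proof.
move=> lphi K0 eps0 [adm neg].
have [d1 d10 d1P] : exists2 d : R, 0 < d &
    forall u', `|u' - u| < d -> admissible S u' o.
  elim: o adm {neg} => [|a o IH] adm; first by exists 1.
  have [|d d0 dP] := IH; first by move=> b bo; apply: adm; rewrite in_cons bo orbT.
  have [Sa a0 au] := adm a (mem_head _ _).
  exists (Num.min d (a.1.2.+1%:R^-1 - `|a.2.2 - u|)).
    by rewrite lt_min d0 subr_gt0.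
  move=> u'; rewrite lt_min => /andP[/dP h1 h2] b.
  rewrite in_cons => /predU1P[->|]; last exact: h1.
  split => //; have := ler_normD (a.2.2 - u) (u - u').
  rewrite addrA subrK (distrC u u'); move: (_%:R^-1) h2 => r; lra.
set A := increment _ _ _ _ + _ in neg.
pose M := 2 * K + (K + eps + 1) * \sum_(a <- o) a.2.1.
have o0 a : a \in o -> 0 <= a.2.1 by move=> /adm[].
have M0 : 0 <= M.
  rewrite addr_ge0 ?mulr_ge0 ?addr_ge0// ?(ltW eps0)//.
  by rewrite big_seq sumr_ge0.
exists (Num.min d1 (- A / (M + 1))).
  by rewrite lt_min d10 divr_gt0// ?oppr_gt0// ltr_wpDl.
move=> u'; rewrite lt_min => /andP[/d1P ? h2]; split=> //.
apply: le_lt_trans (violation_continuous u u' lphi K0 eps0 o0) _.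
rewrite -/A -/M; have M1 : 0 < M + 1 by rewrite ltr_wpDl.
rewrite ltr_pdivlMr// in h2.
have := normr_ge0 (u' - u); rewrite mulrDr in h2; lra.
Qed.

(* [L] is the closure of a countable set that contains, for each of its points
   and each radius [1 / (m + 1)], the vectors of a violation valid on the whole
   ball, as soon as there is one in [W]. *)
Lemma separable_reduction phi K S eps w0 : lipschitz_fun K phi -> 0 <= K ->
  0 < eps -> exists L : submodClosed W, [/\ w0 \in L,
    separable (subspace_of L),
    (forall x, (forall e : R, 0 < e -> exists2 y, y \in L & `|x - y| < e) -> x \in L) &
    forall w o, w \in L -> violation phi S eps w o ->
      exists o', [/\ map fst o' = map fst o, violation phi S eps w o' &
        forall a, a \in o' -> a.2.2 \in L]].
Proof.
move=> lphi K0 eps0.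
have /choice[wit witP] (x : seq (nat * nat) * nat * W) : exists o : seq entry,
    (exists o', map fst o' = x.1.1 /\
       forall u, `|u - x.2| < x.1.2.+1%:R^-1 -> violation phi S eps u o') ->
    map fst o = x.1.1 /\
    forall u, `|u - x.2| < x.1.2.+1%:R^-1 -> violation phi S eps u o.
  have [[r rP]|no] := pselect (exists o', map fst o' = x.1.1 /\
       forall u, `|u - x.2| < x.1.2.+1%:R^-1 -> violation phi S eps u o').
    by exists r.
  by exists [::].
(* The operations are sums, rational multiples, and the [i]-th vector of the chosen violation with
   profile [kap] on the ball of radius [1 / (m + 1)] about [x]. *)
pose J : countType := (unit + rat + (seq (nat * nat) * nat * nat))%type.
pose op (j : J) (x y : W) : W := match j with
  | inl (inl _) => x + y
  | inl (inr q) => ratr q *: x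
  | inr ((kap, m), i) => (nth (0%N, 0%N, (0, 0)) (wit (kap, m, x)) i).2.2
  end.
have [u [[n0 un0] uop]] := countable_op_closure op w0.
have [|q n|L LP] := @closed_span_of_rat _ _ u.
- by move=> m n; have := uop (inl (inl tt)) m n.
- by have := uop (inl (inr q)) n n.
have uL n : u n \in L by apply/LP => e e0; exists n; rewrite subrr normr0.
exists L; split.
- by rewrite -un0.
- apply/separableP; exists (fun n => SubspaceOf (uL n)) => x e e0.
  by have [n xn] := (LP _).1 (valP x) e e0; exists n.
- move=> x xL; apply/LP => e e0; have e20 : 0 < e / 2 by lra.
  have [y yL xy] := xL _ e20; have [n yn] := (LP y).1 yL _ e20.
  by exists n; have := ler_normD (x - y) (y - u n); rewrite addrA subrK; lra.
move=> w o wL vw; have [d d0 dP] := violation_open lphi K0 eps0 vw.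
(* The centre [u n] will be within [1 / (m + 1)] of [w], so that twice this radius has to fit into
   [d]. *)
have [m md] : exists m : nat, m.+1%:R^-1 < d / 2.
  exists (Num.bound (d / 2)^-1); rewrite invf_plt ?posrE//; last lra.
  have h : 0 <= (d / 2)^-1 by rewrite invr_ge0; lra.
  by apply: lt_trans (archi_boundP h) _; rewrite ltr_nat.
have m0 : 0 < m.+1%:R^-1 :> R by rewrite invr_gt0.
have [n wn] := (LP w).1 wL _ m0.
have [|om oP] := witP (map fst o, m, u n).
  exists o; split => // v /= vn; apply: dP.
  have := ler_normD (v - u n) (u n - w); rewrite addrA subrK (distrC (u n)).
  by move: (_%:R^-1) md vn wn => r; lra.
exists (wit (map fst o, m, u n)); split => //; first exact: oP.
move=> a /(nthP (0%N, 0%N, (0, 0)))[i _ <-].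
have [k uk] := uop (inr (map fst o, m, i)) n n.
by have := uL k; rewrite uk.
Qed.

End separable_reduction.

(** * The sum rule in Asplund spaces *)

Section fuzzy_sum_rule.
Context (R : realType).

(** The normal cone is a parameter, so that the Clarke and Frechet cases share the rest of the
    argument. *)
Definition fuzzy_sum_rule (N : normal_cone_map R) (W : normedModType R) :=
  forall (phi : W -> R) (K : R) (S : set W) (w0 : W) (eps : R),
  closed S -> convex_fun phi -> lipschitz_fun K phi -> 0 <= K -> S w0 ->
  (forall y, S y -> phi w0 <= phi y) -> 0 < eps ->
  exists w p, [/\ `|w - w0| < eps, N W S w p &
    forall h, - (p h : R) <= phi (w + h) - phi w + eps + eps * `|h|].

(** The sandwich theorem is applied to [increment] and the cone of combinations paired with their
    negated weights; absence of violations says that this cone lies below [increment]. Lists with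
    one entry then show that the negated functional is a Frechet normal. *)
Lemma violation_free (W : normedModType R) (phi : W -> R) K S eps w
  (k : nat -> nat) : convex_fun phi -> lipschitz_fun K phi -> 0 <= K ->
  0 < eps -> S w ->
  (forall r, (forall a, a \in r -> a.1.2 = k a.1.1) ->
     ~ violation phi S eps w r) ->
  exists2 p : dual W, frechet_normal S w p &
    forall h, - (p h : R) <= increment phi eps w h.
Proof.
move=> cphi lphi K0 eps0 Sw viol.
pose C : set (W * R) := [set v | exists r : seq (nat * nat * (R * W)),
  [/\ forall a, a \in r -> a.1.2 = k a.1.1, admissible S w r,
      v.1 = comb w r & v.2 = - comb_weight w r]].
have [||||[v t] [r [/= ok adm -> ->]]|p [pinc pC _]] :=
    @convex_cone_sandwich R W (increment phi eps w) (K + eps) C.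
- exact: increment_convex.
- exact: increment_lipschitz.
- by rewrite addr_ge0// ltW.
- split=> [|[v t] [v' t'] [r [/= ok adm -> ->]] [r' [/= ok' adm' -> ->]]|].
  + by exists [::]; split=> //; rewrite /comb /comb_weight big_nil ?oppr0.
  + exists (r ++ r'); split; rewrite ?comb_cat ?comb_weight_cat ?opprD//.
    * by move=> a; rewrite mem_cat => /orP[/ok|/ok'].
    * by move=> a; rewrite mem_cat => /orP[/adm|/adm'].
  + move=> a [v t] a0 [r [/= ok adm -> ->]].
    exists [seq (b.1, (a * b.2.1, b.2.2)) | b <- r]; split => /=.
    * by move=> _ /mapP[b /ok bk ->].
    * move=> _ /mapP[b /adm[Sb b0 bw] ->]; split => //=.
      by rewrite mulr_ge0// ltW.
    * rewrite /comb big_map scaler_sumr; apply: eq_bigr => b _ /=.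
      by rewrite scalerA.
    * rewrite /comb_weight big_map mulrN mulr_sumr; congr (- _).
      by apply: eq_bigr => b _ /=; rewrite mulrA.
- by rewrite -subr_ge0 opprK leNgt; apply/negP => neg; apply: (viol r).
exists (- p); last by move=> h; rewrite dual_oppE opprK.
apply/frechet_normalP; split=> // e e0.
have [n ne] : exists n : nat, n.+1%:R^-1 < e.
  exists (Num.bound e^-1); rewrite invf_plt ?posrE//.
  have h : 0 <= e^-1 by rewrite invr_ge0 ltW.
  by apply: lt_trans (archi_boundP h) _; rewrite ltr_nat.
exists (k n).+1%:R^-1; first by rewrite invr_gt0.
move=> s Ss sw; rewrite dual_oppE.
have := pC (1 *: (s - w), - (1 * (n.+1%:R^-1 * `|s - w|))).
rewrite /= scale1r mul1r lerNl => h.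
apply: le_trans (ler_wpM2r (normr_ge0 _) (ltW ne)); apply: h.
exists [:: ((n, k n), (1, s))]; split => /=.
- by move=> a; rewrite inE => /eqP->.
- by move=> a; rewrite inE => /eqP->; split.
- by rewrite /comb big_seq1 /= scale1r.
- by rewrite /comb_weight big_seq1 /= mul1r.
Qed.

Lemma subspace_geo_complete (W : normedModType R) (L : submodClosed W) :
  geo_complete W ->
  (forall x, (forall e : R, 0 < e -> exists2 y, y \in L & `|x - y| < e) ->
     x \in L) ->
  geo_complete (subspace_of L).
Proof.
move=> cW clL u c uc; have [l lP] := cW (fun k => \val (u k)) c uc.
have lL : l \in L.
  apply: clL => e /(half_pow_small (2 * c))[k /(_ k (leqnn k)) kP].
  exists (\val (u k)); first exact: valP.
  by rewrite distrC; exact: le_lt_trans (lP k) kP.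
by exists (SubspaceOf lL).
Qed.

(** The separable case provides a point [x] and a normal [q] in [L]. The point is kept; a normal in
    [W] is obtained anew from [violation_free], and [q] serves only to exclude violations. *)
Lemma frechet_fuzzy_sum (W : normedModType R) : geo_complete W ->
  asplund_normed W -> fuzzy_sum_rule (@frechet_normal R) W.
Proof.
move=> cW asW phi K S w0 eps clS cphi lphi K0 Sw0 phimin eps0.
have [L [w0L sepL clL lift]] := separable_reduction S w0 lphi K0 eps0.
have /separableP[g dg] := asW L sepL.
pose SL : set (subspace_of L) := [set x | S (\val x)].
have clSL : closed SL.
  apply: closed_limits => l h; apply: closed_limit clS _ => e /h[s Ss sl].
  by exists (\val s).
have [||||||x [q [xw0 xq qphi]]] := @frechet_fuzzy_sum_separable R (subspace_of L)
    (fun x => phi (\val x)) K SL (SubspaceOf w0L) g eps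
    (subspace_geo_complete cW clL) dg clSL.
- by move=> x y t t0 t1; have := cphi (\val x) (\val y) t t0 t1; exact.
- by move=> x y; exact: lphi.
- by [].
- by [].
- by move=> y; exact: phimin.
- by [].
have [Sx qx] := (frechet_normalP _ _ _).1 xq.
(* Normality of [q] in [L] determines the radii for which violations in [W] are to be excluded. *)
have /choice[k kP] (n : nat) : exists k : nat, forall s, SL s ->
    `|s - x| < k.+1%:R^-1 -> (q (s - x) : R) <= n.+1%:R^-1 * `|s - x|.
  have [|d d0 dP] := qx n.+1%:R^-1; first by rewrite invr_gt0.
  exists (Num.bound d^-1) => s Ss sx; apply: dP => //; apply: lt_trans sx _.
  rewrite invf_plt ?posrE//.
  have h : 0 <= d^-1 by rewrite invr_ge0 ltW.
  by apply: lt_trans (archi_boundP h) _; rewrite ltr_nat.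
have [r ok vo|p pN pinc] := violation_free (k := k) cphi lphi K0 eps0 (w := \val x) Sx.
(* A violation in [W] has a counterpart with vectors in [L]. There its weight is at least [q v] and
   its increment at least [- q v], so their sum cannot be negative. *)
- have [r' [oo' [adm' neg] o'L]] := lift (\val x) r (valP x) vo.
  have ok' a : a \in r' -> a.1.2 = k a.1.1.
    move=> /(map_f fst); rewrite oo' => /mapP[b /ok bk ->]; exact: bk.
  pose lf (s : W) : subspace_of L := insubd 0 s.
  have lfK s : s \in L -> \val (lf s) = s by exact: insubdK.
  pose v := \sum_(a <- r') a.2.1 *: (lf a.2.2 - x).
  have vE : \val v = comb (\val x) r'.
    rewrite /v /comb raddf_sum /= big_seq [RHS]big_seq.
    by apply: eq_bigr => a /o'L aL; rewrite -[in RHS](lfK _ aL).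
  have qv : (q v : R) <= comb_weight (\val x) r'.
    rewrite /v raddf_sum /= /comb_weight big_seq [leRHS]big_seq.
    apply: ler_sum => a ao'; have [Sa a0 ax] := adm' a ao'.
    rewrite dual_scaleE ler_wpM2l//.
    have aL := lfK _ (o'L a ao').
    have <- : `|lf a.2.2 - x| = `|a.2.2 - \val x|.
      by rewrite -[in RHS]aL.
    apply: kP; first by rewrite /SL /= aL.
    by rewrite -ok'//; move: ax; rewrite -[in X in X -> _]aL.
  have h : - (q v : R) <= increment phi eps (\val x) (\val v) := qphi v.
  by rewrite vE in h; lra.
by exists (\val x), p; split.
Qed.

End fuzzy_sum_rule.

(** * Extension of functionals and products of Asplund spaces *)

Section asplund_product.
Context (R : realType).

Lemma dual_precomp (V W : normedModType R) (T : V -> W) (f : dual W) :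
  linear T -> (forall x, `|T x| <= `|x|) ->
  exists2 g : dual V, (forall x, g x = f (T x) :> R) & `|g| <= `|f|.
Proof.
move=> lT cT; apply: (@dual_of_bounded R V (fun x => f (T x))) => //.
  by move=> a x y; rewrite lT dual_addv dual_scaleE.
by move=> x; apply: le_trans (dual_le _ _) _; rewrite ler_wpM2l.
Qed.

(** The sandwich theorem with the graph of [f] as the cone: the functional obtained dominates [f] on
    [L], and equality follows by passing to [- x]. *)
Lemma dual_extension (V : normedModType R) (L : submodClosed V)
  (f : dual (subspace_of L)) :
  exists p : dual V, forall x, p (\val x) = f x :> R.
Proof.
pose C : set (V * R) := [set v | exists x, v = (\val x, f x : R)].
have [||||_ [x ->]|p [_ pC _]] :=
    @convex_cone_sandwich R V (fun h => `|f| * `|h|) `|f| C.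
- move=> x y t t0 t1; have := convex_norm x y t0 t1.
  by move=> /(ler_wpM2l (normr_ge0 f)); rewrite mulrDr; lra.
- move=> x y; rewrite -mulrBr ler_wpM2l//.
  by have := @lipschitz_norm R V x y; rewrite mul1r.
- by [].
- split=> [|_ _ [x ->] [y ->]|a _ a0 [x ->]].
  + by exists 0; rewrite dual_0v.
  + by exists (x + y); rewrite dual_addv.
  + by exists (a *: x); rewrite dual_scaleE.
- exact: dual_le.
exists p => x; apply/le_anti/andP; split.
  have := pC (\val (- x), f (- x) : R); rewrite /= !dual_oppv lerN2; apply.
  by exists (- x); rewrite dual_oppv.
by apply: (pC (\val x, f x : R)); exists x.
Qed.

Lemma separable_of_countable (V : normedModType R) (I : countType) (i0 : I)
  (u : I -> V) :
  (forall x (e : R), 0 < e -> exists i, `|x - u i| < e) -> separable V.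
Proof.
move=> du; apply/separableP.
exists (fun n => u (odflt i0 (unpickle n))) => x e /(du x)[i xi].
by exists (pickle i); rewrite pickleK.
Qed.

Lemma separable_linear_image (V W : normedModType R) (L : submodClosed V)
  (T : V -> W) : linear T -> (forall x, `|T x| <= `|x|) ->
  separable (subspace_of L) ->
  exists L' : submodClosed W, separable (subspace_of L') /\
    forall x, x \in L -> T x \in L'.
Proof.
move=> lT cT /separableP[u du].
have T0 : T 0 = 0.
  by have := lT (-1) 0 0; rewrite scaler0 addr0 scaleN1r addNr.
have TB x y : T (x - y) = T x - T y.
  by rewrite -[- y]scaleN1r [x + _]addrC lT scaleN1r addrC.
have h : submod_closed (mem (T @` [set x | x \in L]) : {pred W}).
  split=> [|a x y]; rewrite !inE; first by exists 0; rewrite //= rpred0.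
  move=> [x' /= xL <-] [y' /= yL <-]; exists (a *: x' + y'); rewrite ?lT//=.
  by rewrite rpredD// rpredZ.
pose L' : submodClosed W := HB.pack (mem (T @` [set x | x \in L]) : {pred W})
  (GRing.isSubmodClosed.Build R W _ h).
have TL x : x \in L -> T x \in L' by move=> xL; rewrite inE; exists x.
exists L'; split => //; apply/separableP.
exists (fun n => SubspaceOf (TL _ (valP (u n)))) => -[y yL'] e e0.
have [x xL xy] : exists2 x, x \in L & T x = y by move: yL'; rewrite inE.
have [n xn] := du (SubspaceOf xL) e e0; exists n.
apply: le_lt_trans xn; apply: le_trans (cT _).
by rewrite TB xy.
Qed.

(** A functional on [L] extends to the product, where it is a sum of functionals of the two
    coordinates. These restrict to the projections [LV] and [LW] of [L], whose duals have dense
    sequences; the sums of their members are dense in the dual of [L]. *)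
Lemma asplund_prod (V W : normedModType R) :
  asplund_normed V -> asplund_normed W -> asplund_normed (V * W)%type.
Proof.
move=> aV aW L sL.
have lfst : linear (fst : V * W -> V) by [].
have lsnd : linear (snd : V * W -> W) by [].
have cfst (x : V * W) : `|x.1| <= `|x| by rewrite prod_normE le_max lexx.
have csnd (x : V * W) : `|x.2| <= `|x| by rewrite prod_normE le_max lexx orbT.
have [LV [/aV/separableP[g dg] LVP]] := separable_linear_image lfst cfst sL.
have [LW [/aW/separableP[k dk] LWP]] := separable_linear_image lsnd csnd sL.
pose T (x : subspace_of L) : subspace_of LV := SubspaceOf (LVP _ (valP x)).
pose T' (x : subspace_of L) : subspace_of LW := SubspaceOf (LWP _ (valP x)).
have lT : linear T by move=> a x y; exact/val_inj.
have lT' : linear T' by move=> a x y; exact/val_inj.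
have cT x : `|T x| <= `|x| by exact: cfst.
have cT' x : `|T' x| <= `|x| by exact: csnd.
have /choice[G GP] (i : nat * nat) : exists f : dual (subspace_of L),
    forall x, f x = (g i.1 (T x) : R) + k i.2 (T' x) :> R.
  have [f fE _] := dual_precomp (g i.1) lT cT.
  have [f' fE' _] := dual_precomp (k i.2) lT' cT'.
  by exists (f + f') => x; rewrite dual_addE fE fE'.
apply: (separable_of_countable (0%N, 0%N) (u := G)) => f e e0.
have [p pf] := dual_extension f.
have [f1 f1E _] : exists2 h : dual (subspace_of LV),
    (forall x, h x = p (\val x, 0) :> R) & `|h| <= `|p|.
  apply: (@dual_precomp _ _ (fun x : subspace_of LV => (\val x, 0 : W)) p).
    by move=> a x y; rewrite [RHS](_ : _ = (a *: \val x + \val y, a *: 0 + 0))//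
      scaler0 addr0.
  by move=> x; rewrite prod_normE /= normr0 ge_max lexx normr_ge0.
have [f2 f2E _] : exists2 h : dual (subspace_of LW),
    (forall x, h x = p (0, \val x) :> R) & `|h| <= `|p|.
  apply: (@dual_precomp _ _ (fun x : subspace_of LW => (0 : V, \val x)) p).
    by move=> a x y; rewrite [RHS](_ : _ = (a *: 0 + 0, a *: \val x + \val y))//
      scaler0 addr0.
  by move=> x; rewrite prod_normE /= normr0 ge_max lexx normr_ge0.
have e20 : 0 < e / 2 by lra.
have [m fm] := dg f1 _ e20; have [n fn] := dk f2 _ e20.
exists (m, n); apply: le_lt_trans (_ : `|f1 - g m| + `|f2 - k n| < _); last lra.
apply: dual_norm_leP => [|x]; first by rewrite addr_ge0.
rewrite dual_addE dual_oppE GP /= -pf.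
have -> : p (\val x) = (f1 (T x) : R) + f2 (T' x) :> R.
  rewrite f1E f2E -dual_addv; congr (dual_val p _).
  by case: x => [[x1 x2] ?]; congr pair; rewrite /= ?addr0 ?add0r.
have := dual_le (f1 - g m) (T x); have := dual_le (f2 - k n) (T' x).
rewrite !dual_addE !dual_oppE.
have := ler_wpM2l (normr_ge0 (f1 - g m)) (cT x).
have := ler_wpM2l (normr_ge0 (f2 - k n)) (cT' x).
rewrite mulrDl; lra.
Qed.

End asplund_product.

(** * The sum rule for Clarke normals *)

Section clarke_fuzzy_sum.
Context (R : realType) (V : normedModType R).
Implicit Types (S : set V) (z v : V).

Lemma clarke_tangent0 S z : clarke_tangent S z 0.
Proof.
move=> u t Su uz t0 tz; exists (fun=> 0); first exact: cvg_cst.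
by move=> k; rewrite scaler0 addr0.
Qed.

(** The second tangent direction is used from the points [u k + t k *: a k] reached along the first,
    which lie in [S] and still converge to [z]. *)
Lemma clarke_tangentD S z v v' :
  clarke_tangent S z v -> clarke_tangent S z v' -> clarke_tangent S z (v + v').
Proof.
move=> Tv Tv' u t Su uz t0 tz.
have [a av aS] := Tv u t Su uz t0 tz.
have [|b bv bS] := Tv' (fun k => u k + t k *: a k) t aS _ t0 tz.
  rewrite -[z]addr0 -(scale0r v); apply: cvgD => //; exact: cvgZ.
exists (fun k => a k + b k); first exact: cvgD.
by move=> k; rewrite scalerDr addrA; exact: bS.
Qed.

Lemma clarke_tangentZ S z v (c : R) : 0 < c ->
  clarke_tangent S z v -> clarke_tangent S z (c *: v).
Proof.
move=> c0 Tv u t Su uz t0 tz.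
have [||a av aS] := Tv u (fun k => c * t k) Su uz.
- by move=> k; rewrite mulr_gt0.
- by rewrite -(mulr0 c); apply: cvgMr.
exists (fun k => c *: a k); first exact: cvgZr.
by move=> k; rewrite scalerA mulrC; exact: aS.
Qed.

(** The minimizer [w0] itself serves: [phi] does not decrease along Clarke tangent directions, and
    the sandwich theorem separates its increments from the tangent cone. *)
Lemma clarke_fuzzy_sum : fuzzy_sum_rule (@clarke_normal R) V.
Proof.
move=> phi K S w0 eps _ cphi lphi K0 Sw0 phimin eps0.
pose C : set (V * R) := [set u | clarke_tangent S w0 u.1 /\ u.2 = 0].
have [||||[v _] [/= Tv ->]|p [pphi pC _]] :=
    @convex_cone_sandwich R V (fun h => phi (w0 + h) - phi w0) K C.
- move=> x y t t0 t1; have := cphi (w0 + x) (w0 + y) t t0 t1.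
  have t1E : t + (1 - t) = 1 by rewrite addrC subrK.
  by rewrite !scalerDr addrACA -scalerDl t1E scale1r; lra.
- move=> x y; have := lphi (w0 + x) (w0 + y).
  by rewrite opprD addrACA subrr add0r; lra.
- by [].
- split=> [|u u' [Tu u0] [Tu' u0']|a u a0 [Tu u0]].
  + by split=> //; exact: clarke_tangent0.
  + by split; [exact: clarke_tangentD|rewrite /= u0 u0' addr0].
  + by split; [exact: clarke_tangentZ|rewrite /= u0 mulr0].
(* For the constant sequence [w0] the tangent condition yields points of [S] at which minimality can
   be used. *)
- have [||||a av aS] := Tv (fun=> w0) (@harmonic R) => //.
  + exact: cvg_cst.
  + by move=> k; exact: harmonic_gt0.
  + exact: cvg_harmonic.
  rewrite subr_ge0; apply: ler_addeps => e e0.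
  have e1 : 0 < e / (K + 1) by rewrite divr_gt0// ltr_wpDl.
  have [N _ /(_ N (leqnn N)) aN] : \forall k \near \oo, `|v - a k| <= e / (K + 1).
    by move/cvgrPdist_le: av; exact.
  have t0 := harmonic_gt0 N : 0 < harmonic N :> R.
  have t1 : harmonic N <= 1 :> R by rewrite /harmonic invf_le1// ler1n.
  have h1 := phimin _ (aS N).
  have := lphi (w0 + harmonic N *: a N) (w0 + harmonic N *: v).
  rewrite opprD addrACA subrr add0r -scalerBr normrZ gtr0_norm// distrC => h2.
  (* Convexity turns the inequality for the small step [harmonic N] into one for the full step
     [v]. *)
  have := cphi (w0 + v) w0 _ (ltW t0) t1.
  have -> : harmonic N *: (w0 + v) + (1 - harmonic N) *: w0 = w0 + harmonic N *: v.
    by rewrite scalerDr scalerBl scale1r [LHS]addrC addrA subrK.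
  move=> h3.
  have h4 : K * `|v - a N| <= e.
    apply: le_trans (ler_wpM2l K0 aN) _.
    rewrite mulrA ler_pdivrMr ?ltr_wpDl// mulrC ler_wpM2l// ?ltW//; lra.
  have h5 := ler_wpM2l (ltW t0) h4; rewrite mulrCA in h5.
  suff : harmonic N * phi w0 <= harmonic N * (phi (w0 + v) + e) by rewrite ler_pM2l.
  move: (harmonic N : R) h1 h2 h3 h5 => t h1 h2 h3 h5; rewrite mulrDr; lra.
exists w0, (- p); split.
- by rewrite subrr normr0.
- split=> // v Tv; rewrite dual_oppE oppr_le0.
  by apply: (pC (v, 0)).
- move=> h; rewrite dual_oppE opprK; have := pphi h.
  by have := mulr_ge0 (ltW eps0) (normr_ge0 h); lra.
Qed.

End clarke_fuzzy_sum.

(** * Separation and multipliers *)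

Section normal_cone_products.
Context (R : realType).

(** This and the next two properties, with the sum rule, are what the multiplier argument uses of a
    normal cone. *)
Definition splits_products (N : normal_cone_map R) :=
  forall (V W : normedModType R) (A : set V) (B : set W) (a : V) (b : W)
    (p : dual (V * W)%type) (q : dual V) (q' : dual W),
  (forall x y, p (x, y) = (q x : R) + q' y :> R) ->
  N _ (A `*` B) (a, b) p -> N _ A a q /\ N _ B b q'.

Definition normals_based_in_set (N : normal_cone_map R) :=
  forall (V : normedModType R) (A : set V) (a : V) (p : dual V),
  N _ A a p -> A a.

Definition positively_homogeneous (N : normal_cone_map R) :=
  forall (V : normedModType R) (A : set V) (a : V) (p : dual V) (c : R),
  0 < c -> N _ A a p -> N _ A a (c *: p).

Lemma frechet_splits_products : splits_products (@frechet_normal R).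
Proof.
move=> V W A B a b p q q' pE /frechet_normalP[[/= Aa Bb] pN].
split; apply/frechet_normalP; split=> // e /pN[d d0 dP]; exists d => //.
  move=> s As sa; have E : `|(s, b) - (a, b)| = `|s - a|.
    by rewrite prod_normE /= subrr normr0; apply/max_idPl.
  by have := dP (s, b) (conj As Bb); rewrite E pE /= subrr dual_0v addr0; apply.
move=> s Bs sb; have E : `|(a, s) - (a, b)| = `|s - b|.
  by rewrite prod_normE /= subrr normr0; apply/max_idPr.
by have := dP (a, s) (conj Aa Bs); rewrite E pE /= subrr dual_0v add0r; apply.
Qed.

Lemma frechet_positively_homogeneous :
  positively_homogeneous (@frechet_normal R).
Proof.
move=> V A a p c c0 /frechet_normalP[Aa pN].
apply/frechet_normalP; split=> // e e0.
have [d d0 dP] := pN _ (divr_gt0 e0 c0); exists d => // s As /(dP s As).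
by rewrite dual_scalE -ler_pdivlMl// mulrA [c^-1 * e]mulrC.
Qed.

Lemma clarke_tangent_prodl (V W : normedModType R) (A : set V) (B : set W) a b v :
  clarke_tangent A a v -> clarke_tangent (A `*` B) (a, b) (v, 0).
Proof.
move=> Tv u t Su uab t0 tz.
have [||w wv wA] := Tv (fun k => (u k).1) t _ _ t0 tz.
- by move=> k; have [] := Su k.
- by apply: (@cvg_comp _ _ _ u fst _ (nbhs (a, b))) => //; exact: cvg_fst.
exists (fun k => (w k, 0)); first by apply: cvg_pair => //; exact: cvg_cst.
move=> k; have [/= _ Bk] := Su k.
by split; [exact: wA|rewrite /= scaler0 addr0].
Qed.

Lemma clarke_tangent_prodr (V W : normedModType R) (A : set V) (B : set W) a b v :
  clarke_tangent B b v -> clarke_tangent (A `*` B) (a, b) (0, v).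
Proof.
move=> Tv u t Su uab t0 tz.
have [||w wv wB] := Tv (fun k => (u k).2) t _ _ t0 tz.
- by move=> k; have [] := Su k.
- by apply: (@cvg_comp _ _ _ u snd _ (nbhs (a, b))) => //; exact: cvg_snd.
exists (fun k => (0, w k)); first by apply: cvg_pair => //; exact: cvg_cst.
move=> k; have [/= Ak _] := Su k.
by split; [rewrite /= scaler0 addr0|exact: wB].
Qed.

Lemma clarke_splits_products : splits_products (@clarke_normal R).
Proof.
move=> V W A B a b p q q' pE [[/= Aa Bb] pN]; split; split=> // v Tv.
  have := pN (v, 0) (clarke_tangent_prodl Tv).
  by rewrite pE dual_0v addr0.
have := pN (0, v) (clarke_tangent_prodr Tv).
by rewrite pE dual_0v add0r.
Qed.

Lemma clarke_positively_homogeneous : positively_homogeneous (@clarke_normal R).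
Proof.
move=> V A a p c c0 [Aa pN]; split=> // v /pN pv.
by rewrite dual_scalE mulr_ge0_le0// ltW.
Qed.

Lemma dual_pair_split (V W : normedModType R) (p : dual (V * W)%type) :
  exists (q : dual V) (q' : dual W), p = dual_pair q q'.
Proof.
have [q qE _] : exists2 h : dual V,
    (forall x, h x = p (x, 0) :> R) & `|h| <= `|p|.
  apply: (@dual_precomp _ _ _ (fun x : V => (x, 0 : W)) p).
    by move=> a x y; rewrite [RHS](_ : _ = (a *: x + y, a *: 0 + 0))//
      scaler0 addr0.
  by move=> x; rewrite prod_normE /= normr0 ge_max lexx normr_ge0.
have [q' qE' _] : exists2 h : dual W,
    (forall x, h x = p (0, x) :> R) & `|h| <= `|p|.
  apply: (@dual_precomp _ _ _ (fun x : W => (0 : V, x)) p).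
    by move=> a x y; rewrite [RHS](_ : _ = (a *: 0 + 0, a *: x + y))//
      scaler0 addr0.
  by move=> x; rewrite prod_normE /= normr0 ge_max lexx normr_ge0.
exists q, q'; apply/val_inj/funext => -[x y] /=.
rewrite /dual_pair_fun /= qE qE' -dual_addv.
by rewrite [X in dual_val p X](_ : _ = (x + 0, 0 + y))// addr0 add0r.
Qed.

Lemma dual_pairZ (V W : normedModType R) (c : R) (q : dual V) (q' : dual W) :
  c *: dual_pair q q' = dual_pair (c *: q) (c *: q').
Proof. by apply/val_inj/funext => z; exact: scalerDr. Qed.

(** The additive constant disappears when the bound is applied to [s *: h] and divided by a large
    [s]. *)
Lemma dual_affine_norm_le (V : normedModType R) (q : dual V) (M c : R) :
  0 <= M -> (forall h, (q h : R) <= M * `|h| + c) -> `|q| <= M.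
Proof.
move=> M0 qM; apply: dual_norm_leP => // h; apply: ler_addeps => e e0.
have c0 : 0 <= c by have := qM 0; rewrite dual_0v normr0 mulr0 add0r.
pose s := (c + 1) / e.
have s0 : 0 < s by rewrite divr_gt0// ltr_wpDl.
have se : s * e = c + 1 by rewrite /s divfK// gt_eqF.
have := qM (s *: h); rewrite dual_scaleE normrZ gtr0_norm// => hs.
rewrite -(ler_pM2l s0) mulrDr se; lra.
Qed.

Lemma dual_pair_norm_le (V W : normedModType R) (q : dual V) (q' : dual W) (M : R) :
  0 <= M -> (forall x, (dual_pair q q' x : R) <= M * `|x|) ->
  `|q| <= M /\ `|q'| <= M.
Proof.
move=> M0 pM; split; apply: dual_norm_leP => // x.
  have := pM (x, 0); rewrite /= /dual_pair_fun /= dual_0v addr0 prod_normE /= normr0.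
  by rewrite (max_idPl _).
have := pM (0, x); rewrite /= /dual_pair_fun /= dual_0v add0r prod_normE /= normr0.
by rewrite (max_idPr _).
Qed.

End normal_cone_products.

Lemma subrACA (V : zmodType) (a b c d : V) : a - b - (c - d) = a - c - (b - d).
Proof. by rewrite !opprB addrACA [RHS]addrACA [- b - c]addrC. Qed.

(** * Approximate separation of two closed sets *)

Section separation.
Context (R : realType).

Lemma convex_norm_shift (V : normedModType R) (x y c : V) (t : R) :
  0 <= t -> t <= 1 ->
  `|t *: x + (1 - t) *: y - c| <= t * `|x - c| + (1 - t) * `|y - c|.
Proof.
move=> t0 t1; apply: le_trans (convex_norm (x - c) (y - c) t0 t1).
by rewrite !scalerBr addrACA -opprD -scalerDl [t + _]addrC subrK scale1r.
Qed.

Lemma norm_shift (V : normedModType R) (x h c : V) :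
  `|x + h - c| - `|x - c| <= `|h|.
Proof. by have := ler_normD (x - c) h; rewrite addrAC; lra. Qed.

Context (N : normal_cone_map R).
Hypothesis Nsplit : splits_products N.

Lemma separation (V : normedModType R) (A B : set V) (z z' a0 b0 : V)
  (rho e : R) :
  geo_complete V -> fuzzy_sum_rule N (V * V)%type -> closed A -> closed B ->
  0 < rho -> 0 < e -> e <= 200^-1 -> A a0 -> B b0 ->
  `|a0 - z| < e * rho -> `|b0 - z'| < e * rho ->
  (forall t, `|t| < rho -> A (z + t) -> B (z' + t) -> False) ->
  exists a b (p q : dual V), [/\ N A a p /\ N B b q,
    `|a - a0| < rho, `|b - b0| < rho, `|p + q| <= 50 * e &
    2^-1 <= `|p| <= 3 /\ `|q| <= 3].
Proof.
move=> cV fsr clA clB rho0 e0 e_small Aa0 Bb0 az bz ext.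
pose f (w : V * V) := `|w.1 - z - (w.2 - z')|.
have lf : lipschitz_fun 2 f.
  move=> w w'; apply: le_trans (lerB_dist _ _) _.
  have -> : w.1 - z - (w.2 - z') - (w'.1 - z - (w'.2 - z')) =
      (w - w').1 - (w - w').2.
    by rewrite subrACA [- (w'.1 - z)]opprB [- (w'.2 - z')]opprB !addrA !subrK.
  apply: le_trans (ler_normB _ _) _.
  have : `|(w - w').1| <= `|w - w'| by rewrite prod_normE le_max lexx.
  have : `|(w - w').2| <= `|w - w'| by rewrite prod_normE le_max lexx orbT.
  lra.
have clAB : closed (A `*` B).
  apply: closed_limits => -[l l'] h; split; apply: closed_limit (_ : closed _) _ => //=.
    move=> d /h[[s s'] [/= As _]]; rewrite prod_normE gt_max => /andP[? _].
    by exists s.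
  move=> d /h[[s s'] [/= _ Bs]]; rewrite prod_normE gt_max => /andP[_ ?].
  by exists s'.
(* The values [2 e rho] and [24 e] make the distance [6 d / mu] equal to [rho / 2] and the slope
   [2 mu] equal to [48 e]. *)
have d0 : 0 < 2 * (e * rho) by rewrite !mulr_gt0.
have mu0 : 0 < 24 * e by rewrite mulr_gt0.
have [|tau tau0|w [q0 [c0 [ABw ww0 _ fw]]]] :=
  @variational_principle R _ (fun=> True) f 2 (A `*` B) (a0, b0) _ _
    (prod_geo_complete cV cV) clAB lf (ler0n _ 2) (conj Aa0 Bb0) d0 mu0.
- move=> y _; have fy : 0 <= f y by exact: normr_ge0.
  have : f (a0, b0) <= `|a0 - z| + `|b0 - z'| by exact: ler_normB.
  lra.
- exists (fun x => `|x|); split=> //; first exact: lipschitz_norm.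
  by move=> x; rewrite lexx andbT gerBl ltW.
have {}ww0 : `|w - (a0, b0)| <= rho / 2.
  apply: le_trans ww0 _.
  have -> // : 6 * (2 * (e * rho) / (24 * e)) = rho / 2.
  by field; rewrite gt_eqF.
have {}fw y : (A `*` B) y -> f w <= f y + 48 * e * `|y - w|.
  by move=> /(fw 0%N); rewrite !big_ord0 !addr0 expr0 mulr1; lra.
(* If [f w] vanished, [w.1 - z] would be a common point of the translated sets, of norm at most
   [rho / 2 + rho / 200]. *)
have r0 : 0 < f w.
  rewrite lt_neqAle normr_ge0 andbT eq_sym; apply/negP => /eqP fw0.
  have /eqP := normr0_eq0 fw0; rewrite subr_eq0 => /eqP wz.
  apply: (ext (w.1 - z)).
  - have : `|w.1 - a0| <= `|w - (a0, b0)| by rewrite prod_normE le_max lexx.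
    have := ler_normD (w.1 - a0) (a0 - z); rewrite addrA subrK.
    have : e * rho <= 200^-1 * rho by rewrite ler_wpM2r// ltW.
    lra.
  - by rewrite addrC subrK; have [] := ABw.
  - by rewrite wz addrC subrK; have [] := ABw.
pose phi y := f y + 48 * e * `|y - w|.
have e48 : 0 <= 48 * e by rewrite mulr_ge0// ltW.
have cphi : convex_fun phi.
  move=> x y t t0 t1; rewrite /phi.
  have h1 : f (t *: x + (1 - t) *: y) <= t * f x + (1 - t) * f y.
    rewrite /f /= [X in `|X| <= _]subrACA opprD [X in `|X - _| <= _]addrACA.
    rewrite -!scalerBr; apply: le_trans (convex_norm_shift _ _ _ t0 t1) _.
    by rewrite ![_ - _ - (z - z')]subrACA.
  have h2 : `|t *: x + (1 - t) *: y - w| <= t * `|x - w| + (1 - t) * `|y - w|.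
    exact: convex_norm_shift.
  have := ler_wpM2l e48 h2; lra.
have lphi : lipschitz_fun (2 + 48 * e) phi.
  move=> x y; have h1 := lf x y.
  have := ler_wpM2l e48 (lerB_dist (x - w) (y - w)).
  by rewrite opprB addrA subrK /phi; lra.
pose r := f w; rewrite -/r in r0.
(* The bound [e] serves the norm estimates, [rho / 2] keeps the new point within [rho] of the start,
   and [r / 8] keeps [f] away from zero there. *)
pose d := Num.min e (Num.min (rho / 2) (r / 8)).
have dd : 0 < d by rewrite !lt_min e0 !divr_gt0.
have [de [drho dr]] : d <= e /\ d <= rho / 2 /\ d <= r / 8.
  by rewrite !ge_min !lexx !orbT.
have [||y [p [yw pN pphi]]] := fsr phi _ _ w d clAB cphi lphi _ ABw _ dd.
- by rewrite addr_ge0.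
- by move=> y /fw; rewrite /phi subrr normr0 mulr0 addr0.
case: y yw pN pphi => a b yw pN pphi.
have [q [q' pE]] := dual_pair_split p; rewrite {}pE in pN pphi.
have [qN qN'] :=
  @Nsplit _ _ A B a b (dual_pair q q') q q' (fun x y => erefl) pN.
have pM : `|- dual_pair q q'| <= 3.
  apply: (@dual_affine_norm_le _ _ _ _ d) => // h.
  rewrite dual_oppE; apply: le_trans (pphi h) _.
  have hE : (a, b) + h - (a, b) = h by rewrite addrAC subrr add0r.
  have := lphi ((a, b) + h) (a, b); rewrite hE.
  have := ler_wpM2r (normr_ge0 h) e_small; have := ler_wpM2r (normr_ge0 h) de.
  have := normr_ge0 h; lra.
have [q3 q3'] : `|q| <= 3 /\ `|q'| <= 3.
  apply: dual_pair_norm_le => // x; apply: le_trans (dual_le _ _) _.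
  by rewrite ler_wpM2r// -normrN.
exists a, b, q, q'; split => //.
- have : `|a - w.1| <= `|(a, b) - w| by rewrite prod_normE le_max lexx.
  have : `|w.1 - a0| <= `|w - (a0, b0)| by rewrite prod_normE le_max lexx.
  have := ler_normD (a - w.1) (w.1 - a0); rewrite addrA subrK.
  lra.
- have : `|b - w.2| <= `|(a, b) - w| by rewrite prod_normE le_max lexx orbT.
  have : `|w.2 - b0| <= `|w - (a0, b0)| by rewrite prod_normE le_max lexx orbT.
  have := ler_normD (b - w.2) (w.2 - b0); rewrite addrA subrK.
  lra.
(* Along [(h, h)] the function [f] is constant, so only the slopes [48 e] and [d <= e] remain. *)
- have e50 : 0 <= 50 * e by rewrite mulr_ge0// ltW.
  rewrite -normrN; apply: (@dual_affine_norm_le _ _ _ _ d) => // h.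
  rewrite dual_oppE dual_addE.
  have : - ((q h : R) + q' h) <= phi ((a, b) + (h, h)) - phi (a, b) + d +
    d * `|(h, h)| := pphi (h, h).
  have -> : phi ((a, b) + (h, h)) - phi (a, b) =
     48 * e * (`|(a, b) + (h, h) - w| - `|(a, b) - w|).
    rewrite /phi /f /= [a + h - z - _]subrACA opprD [a + h + _]addrACA subrr addr0.
    by rewrite [a - b - _]subrACA; ring.
  have hn : `|(h, h)| = `|h| by rewrite prod_normE /= maxxx.
  rewrite hn; have : `|(a, b) + (h, h) - w| - `|(a, b) - w| <= `|h|.
    by rewrite -hn; exact: norm_shift.
  move=> /(ler_wpM2l e48).
  have := ler_wpM2r (normr_ge0 h) de.
  have := mulr_ge0 (ltW e0) (normr_ge0 h).
  lra.
- split=> //; rewrite q3 andbT.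
  (* The direction [(- s, 0)] brings [f] from [|s|] down to zero, which forces the first component
     of the normal to be large. The constant error is absorbed because [|s| >= 6 d]. *)
  pose s := a - z - (b - z').
  have sr : r - 2 * d <= `|s|.
    have := lf w (a, b); rewrite -/r distrC /f /= -/s; lra.
  have s0 : 0 < `|s| by lra.
  have : - ((q (- s) : R) + q' 0) <= phi ((a, b) + (- s, 0)) - phi (a, b) + d +
    d * `|(- s, 0 : V)| := pphi (- s, 0).
  rewrite dual_oppv dual_0v addr0 opprK.
  have -> : phi ((a, b) + (- s, 0)) = 48 * e * `|(a, b) + (- s, 0) - w|.
    rewrite /phi /f /= addr0 [a - s - z]addrAC subKr subrr normr0 add0r //.
  have -> : phi (a, b) = `|s| + 48 * e * `|(a, b) - w| by [].
  have sn : `|(- s, 0 : V)| = `|s|.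
    by rewrite prod_normE /= normrN normr0; apply/max_idPl.
  rewrite sn.
  have : `|(a, b) + (- s, 0) - w| - `|(a, b) - w| <= `|s|.
    by rewrite -sn; exact: norm_shift.
  move=> /(ler_wpM2l e48) h1 h2.
  have h3 := dual_ge q s.
  rewrite -(ler_pM2r s0).
  have := ler_wpM2r (ltW s0) e_small; have := ler_wpM2r (ltW s0) de.
  lra.
Qed.

End separation.

(** * Multipliers from approximate stationarity *)

Section stationarity.
Context (R : realType) (N : normal_cone_map R) (X Y : completeNormedModType R).
Hypotheses (Nsub : normals_based_in_set N) (Nsplit : splits_products N).
Hypothesis Nhom : positively_homogeneous N.
Hypothesis fsr : fuzzy_sum_rule N ((X * Y) * (X * Y))%type.
Variables (Omega : set X) (F : X -> set Y) (xbar : X) (ybar : Y).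
Variable Xi : set (set Y).
Hypotheses (clOmega : closed Omega) (clF : closed (gph F)).
Hypothesis clXi : forall A, Xi A -> closed A.
Hypothesis stat : triple_approx_stationary F Omega Xi xbar ybar.

Lemma dist_lt (V : normedModType R) (z : V) (S : set V) (r : R) :
  (dist z S < r%:E)%E -> exists2 a, S a & `|a - z| < r.
Proof. by move=> /ereal_inf_lt[_ [a Sa <-]]; rewrite lte_fin; exists a. Qed.

Lemma stationary_separation (eta : R) : 0 < eta ->
  exists x1 y1 x2 A y2 (u1 u2 : dual X) (v1 v2 : dual Y),
    [/\ (gph F `&` ball (xbar, ybar) eta) (x1, y1),
        (Omega `&` ball xbar eta) x2,
        Xi A /\ (A `&` ball ybar eta) y2,
        [/\ N (gph F) (x1, y1) (dual_pair u1 v1), N Omega x2 u2 & N A y2 v2] &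
        [/\ `|u1 + u2| <= eta, `|v1 + v2| <= eta, 2^-1 <= `|u1| + `|v1|,
            `|u1| <= 3 & `|u2| <= 3]].
Proof.
(* The second bound gives [50 e <= eta] for the sums of the normals and [3 e < eta] for the
   distances to the reference point. *)
move=> eta0; pose e := Num.min (200^-1) (eta / 100).
have e0 : 0 < e by rewrite lt_min invr_gt0 ltr0n divr_gt0.
have [e200 eeta] : e <= 200^-1 /\ e <= eta / 100 by rewrite !ge_min !lexx orbT.
have [rho [A [z [/andP[rho0 rhoe] AXi zball dzA ext]]]] := stat e0.
have near_pt i : exists2 a, A i a & `|a - z i| < e * rho.
  apply: dist_lt; apply: le_lt_trans dzA.
  exact: (le_bigmax _ (fun i => dist (z i) (A i))).
have A0 : A ord0 = gph F by have := AXi ord0.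
have [A' XiA' A1] : exists2 A', Xi A' & Omega `*` A' = A (lift ord0 ord0).
  by have := AXi (lift ord0 ord0).
have [a0 Aa0 az] := near_pt ord0.
have [b0 Ab0 bz] := near_pt (lift ord0 ord0).
have clOA : closed (Omega `*` A').
  apply: closed_limits => -[l l'] h; split=> /=.
    apply: closed_limit clOmega _ => d /h[[s s'] [/= Os _]].
    by rewrite prod_normE gt_max => /andP[? _]; exists s.
  apply: closed_limit (clXi XiA') _ => d /h[[s s'] [/= _ As]].
  by rewrite prod_normE gt_max => /andP[_ ?]; exists s'.
have cXY := prod_geo_complete (@banach_geo_complete R X) (@banach_geo_complete R Y).
rewrite A0 in Aa0; rewrite -A1 in Ab0.
have [|[x1 y1] [[x2 y2] [p [q [[pN qN] aa0 bb0 pq [/andP[p_ge p3] q3]]]]]] :=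
    separation Nsplit cXY fsr clF clOA rho0 e0 e200 Aa0 Ab0 az bz.
  move=> t tr Fzt Azt; have : set0 t; last by [].
  rewrite -ext; split; last by rewrite -ball_normE /= sub0r normrN.
  move=> i _; exists (z i + t); last by rewrite addrAC subrr add0r.
  have [->|->] : i = ord0 \/ i = lift ord0 ord0.
  - by case: i => [[|[|//]] ?]; [left|right]; exact/val_inj.
  - by rewrite A0.
  - by rewrite -A1.
have erho : e * rho <= e by rewrite ler_piMr ?ltW//; apply: lt_le_trans rhoe _; lra.
have close i a c : `|c - a| < rho -> `|a - z i| < e * rho ->
    `|c - (xbar, ybar)| < eta.
  move=> ca ai; have := zball i; rewrite -ball_normE /= distrC.
  have := ler_normD (c - a) (a - z i); rewrite addrA subrK.
  have := ler_normD (c - z i) (z i - (xbar, ybar)); rewrite addrA subrK.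
  lra.
have close1 := close _ _ _ aa0 az; have close2 := close _ _ _ bb0 bz.
have [u1 [v1 pE]] := dual_pair_split p; have [u2 [v2 qE]] := dual_pair_split q.
rewrite {p}pE {q}qE in pN qN p_ge p3 q3 pq.
have [u2N v2N] := @Nsplit _ _ Omega A' x2 y2 (dual_pair u2 v2) u2 v2 (fun x y => erefl) qN.
have : `|(x2, y2) - (xbar, ybar)| = Num.max `|x2 - xbar| `|y2 - ybar|.
  by rewrite prod_normE.
move=> h; rewrite {}h gt_max in close2; have /andP[cx2 cy2] := close2.
have pq' : `|u1 + u2| <= eta /\ `|v1 + v2| <= eta.
  apply: dual_pair_norm_le => [|x]; first exact: ltW.
  have -> : (dual_pair (u1 + u2) (v1 + v2) x : R) =
      (dual_pair u1 v1 + dual_pair u2 v2) x.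
    by rewrite dual_addE /= /dual_pair_fun !dual_addE; ring.
  apply: le_trans (dual_le _ _) _; rewrite ler_wpM2r//.
  by apply: le_trans pq _; lra.
have [u13 _] : `|u1| <= 3 /\ `|v1| <= 3.
  apply: dual_pair_norm_le => // x; apply: le_trans (dual_le _ _) _.
  by rewrite ler_wpM2r.
have [u23 _] : `|u2| <= 3 /\ `|v2| <= 3.
  apply: dual_pair_norm_le => // x; apply: le_trans (dual_le _ _) _.
  by rewrite ler_wpM2r.
exists x1, y1, x2, A', y2, u1, u2, v1, v2; split=> //.
- by split; [exact: Nsub pN|rewrite -ball_normE /= distrC].
- by split; [exact: Nsub u2N|rewrite -ball_normE /= distrC].
- by split=> //; split; [exact: Nsub v2N|rewrite -ball_normE /= distrC].
- have [? ?] := pq'; split=> //; apply: le_trans p_ge _.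
  (* For the maximum norm on the product, the norm of a functional is at most the sum of the norms
     of its components. *)
  apply: dual_norm_leP => [|x]; first by rewrite addr_ge0.
  have x1n : `|x.1| <= `|x| by rewrite prod_normE le_max lexx.
  have x2n : `|x.2| <= `|x| by rewrite prod_normE le_max lexx orbT.
  have := dual_le u1 x.1; have := dual_le v1 x.2.
  have := ler_wpM2l (normr_ge0 u1) x1n; have := ler_wpM2l (normr_ge0 v1) x2n.
  rewrite /= /dual_pair_fun mulrDl; lra.
Qed.

Lemma stationary_multipliers :
  qualification N F Omega xbar ybar ->
  exists2 M : R, 0 < M & forall eps : R, 0 < eps ->
    exists x1 y1 x2 A y2 (ystar : dual Y),
      [/\ (gph F `&` ball (xbar, ybar) eps) (x1, y1),
          (Omega `&` ball xbar eps) x2,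
          Xi A /\ (A `&` ball ybar eps) y2,
          set_add (N A y2) (ball 0 eps) ystar /\ `|ystar| = 1 &
          set_add (set_add (coderivative N F (x1, y1) ystar)
                     (N Omega x2 `&` ball 0 M)) (ball 0 eps) 0].
Proof.
move=> [eps0 eps00 qc].
pose d := Num.min 8^-1 (eps0 / 8).
have d0 : 0 < d by rewrite lt_min invr_gt0 ltr0n divr_gt0.
have [d8 deps0] : d <= 8^-1 /\ d <= eps0 / 8 by rewrite !ge_min !lexx orbT.
(* After division by [|v1| >= d], the bound [|u2| <= 3] becomes [3 / d]; the larger value fits the
   open ball. *)
exists (4 / d); first exact: divr_gt0.
(* The bound [eps * d / 2] keeps the errors below [eps] after division by [|v1|]; [eps0 / 8] is for
   the qualification condition. *)
move=> eps e0; pose eta := Num.min (eps * d / 2) (Num.min (eps0 / 8) (Num.min eps eps0)).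
have eta0 : 0 < eta by rewrite !lt_min !divr_gt0 ?mulr_gt0// e0 eps00.
have [etad [eta8 [etae etae0]]] :
    eta <= eps * d / 2 /\ eta <= eps0 / 8 /\ eta <= eps /\ eta <= eps0.
  by rewrite !ge_min !lexx !orbT.
have [x1 [y1 [x2 [A [y2 [u1 [u2 [v1 [v2 [Fx1 Ox2 [XiA Ay2] [pN u2N v2N]
  [u12 v12 uv u13 u23]]]]]]]]]]] := stationary_separation eta0.
(* Otherwise [|u1| + |u2| >= 1 / 2 - 1 / 8], and division by this sum gives data for the
   qualification condition, although the normalized [u1] and [u2] add up to a functional of norm
   below [eps0]. *)
have v1d : d <= `|v1|.
  rewrite leNgt; apply/negP => v1d.
  pose s := `|u1| + `|u2|.
  have s0 : 3 / 8 <= s by rewrite /s; have := normr_ge0 u2; lra.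
  have sp : 0 < s by lra.
  have si : 0 < s^-1 by rewrite invr_gt0.
  have := qc x1 y1 x2 (s^-1 *: u1) (s^-1 *: u2).
  have -> : `|s^-1 *: u1| + `|s^-1 *: u2| = 1.
    by rewrite !normrZ gtr0_norm// -mulrDr mulVf// gt_eqF.
  rewrite -scalerDr normrZ gtr0_norm//.
  move=> h; have : eps0 <= s^-1 * `|u1 + u2|.
    apply: h => //.
    - by have [? ?] := Fx1; split=> //; apply: le_ball etae0 _ _.
    - by have [? ?] := Ox2; split=> //; apply: le_ball etae0 _ _.
    - exists (s^-1 *: - v1).
        rewrite -ball_normE /= sub0r normrN normrZ normrN gtr0_norm//.
        rewrite ltr_pdivrMl//; apply: lt_le_trans v1d _.
        have := ler_wpM2l (ltW eps00) s0; lra.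
      by rewrite /coderivative /= -scalerN opprK -dual_pairZ; exact: Nhom.
    - exact: Nhom.
  rewrite ler_pdivlMl// => h1.
  have := ler_wpM2l (ltW eps00) s0; lra.
have v0 : 0 < `|v1| by apply: lt_le_trans v1d.
have vi : 0 < `|v1|^-1 by rewrite invr_gt0.
(* The sign of [v1] is reversed because the coderivative pairs [xstar] with [- ystar]. *)
exists x1, y1, x2, A, y2, (`|v1|^-1 *: - v1); split.
- by have [? ?] := Fx1; split=> //; apply: le_ball etae _ _.
- by have [? ?] := Ox2; split=> //; apply: le_ball etae _ _.
- by split=> //; have [? ?] := Ay2; split=> //; apply: le_ball etae _ _.
- split; last by rewrite normrZ normrN gtr0_norm// mulVf// gt_eqF.
  exists (`|v1|^-1 *: v2); first exact: Nhom.
  exists (- (`|v1|^-1 *: (v1 + v2))).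
    rewrite -ball_normE /= sub0r opprK normrZ gtr0_norm// ltr_pdivrMl//.
    apply: le_lt_trans v12 _; have := ler_wpM2r (ltW e0) v1d.
    by have := mulr_gt0 e0 d0; lra.
  by rewrite -scalerN -scalerDr opprD addrCA subrr addr0.
- exists (`|v1|^-1 *: u1 + `|v1|^-1 *: u2).
    exists (`|v1|^-1 *: u1).
      by rewrite /coderivative /= -scalerN opprK -dual_pairZ; exact: Nhom.
    exists (`|v1|^-1 *: u2) => //; split; first exact: Nhom.
    rewrite -ball_normE /= sub0r normrN normrZ gtr0_norm// ltr_pdivrMl//.
    apply: le_lt_trans u23 _; rewrite mulrA ltr_pdivlMr//; lra.
  exists (- (`|v1|^-1 *: (u1 + u2))); last by rewrite -scalerDr subrr.
  rewrite -ball_normE /= sub0r opprK normrZ gtr0_norm// ltr_pdivrMl//.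
  apply: le_lt_trans u12 _; have := ler_wpM2r (ltW e0) v1d.
  by have := mulr_gt0 e0 d0; lra.
Qed.

End stationarity.

Unset Implicit Arguments.
Set Strict Implicit.

Theorem corollary3p2 (R : realType) (X Y : completeNormedModType R)
  (Omega : set X) (F : X -> set Y) (xbar : X) (ybar : Y) (Xi : set (set Y)) :
  Omega xbar -> F xbar ybar -> Xi !=set0 ->
  closed Omega -> closed (gph F) -> (forall A, Xi A -> closed A) ->
  triple_approx_stationary F Omega Xi xbar ybar ->
  (qualification (@clarke_normal R) F Omega xbar ybar ->
    exists2 M : R, 0 < M &
    forall eps : R, 0 < eps ->
    exists (x1 : X) (y1 : Y) (x2 : X) (A : set Y) (y2 : Y) (ystar : dual Y),
      [/\ (gph F `&` ball (xbar, ybar) eps) (x1, y1),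
          (Omega `&` ball xbar eps) x2,
          Xi A /\ (A `&` ball ybar eps) y2,
          set_add (clarke_normal A y2) (ball 0 eps) ystar /\ `|ystar| = 1 &
          set_add
            (set_add (coderivative (@clarke_normal R) F (x1, y1) ystar)
                     (clarke_normal Omega x2 `&` ball 0 M))
            (ball 0 eps) 0]) /\
  (asplund X -> asplund Y ->
   qualification (@frechet_normal R) F Omega xbar ybar ->
    exists2 M : R, 0 < M &
    forall eps : R, 0 < eps ->
    exists (x1 : X) (y1 : Y) (x2 : X) (A : set Y) (y2 : Y) (ystar : dual Y),
      [/\ (gph F `&` ball (xbar, ybar) eps) (x1, y1),
          (Omega `&` ball xbar eps) x2,
          Xi A /\ (A `&` ball ybar eps) y2,
          set_add (frechet_normal A y2) (ball 0 eps) ystar /\ `|ystar| = 1 &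
          set_add
            (set_add (coderivative (@frechet_normal R) F (x1, y1) ystar)
                     (frechet_normal Omega x2 `&` ball 0 M))
            (ball 0 eps) 0]).
Proof.
move=> _ _ _ clO clF clXi stat; split=> [|aX aY].
  apply: stationary_multipliers => //.
  - by move=> V A a p [].
  - exact: clarke_splits_products.
  - exact: clarke_positively_homogeneous.
  - exact: clarke_fuzzy_sum.
(* The sum rule is needed on [(X * Y) * (X * Y)], so the product lemmas are used twice. *)
have aXY : asplund_normed (X * Y)%type by apply: asplund_prod; [exact: aX|exact: aY].
have cXY := prod_geo_complete (@banach_geo_complete R X) (@banach_geo_complete R Y).
apply: stationary_multipliers => //.
- by move=> V A a p [].
- exact: frechet_splits_products.
- exact: frechet_positively_homogeneous.
- by apply: frechet_fuzzy_sum; [exact: prod_geo_complete|exact: asplund_prod].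
Qed.
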